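(* Let $\mathcal{A},\mathcal{B}$ be a minimal counter example to Terao's Conjecture (for line arrangements in $\mathbb{P}^2$), such that $\mathcal{A}$ is free with exponents $d_1\le d_2$. Then the following property holds for the free arrangement $\mathcal{A}$: for any line $L\in\mathcal{A}$, the number $r_L$ of multiple points of $\mathcal{A}$ situated on $L$ satisfies the inequality $$r_L\le d_1.$$
   Context: A line arrangement $\mathcal{A}$ in the complex projective plane $\mathbb{P}^2$ is a finite set of distinct lines, $|\mathcal{A}|$ being the number of lines; it is also regarded as the reduced curve $f=0$ given by the union of the lines, with $f\in S=\mathbb{C}[x,y,z]$ the product of the linear forms defining the lines. Let $$D_0(\mathcal{A})=\{(a,b,c)\in S^3: af_x+bf_y+cf_z=0\}$$ be the graded $S$-module of Jacobian syzygies; a homogeneous syzygy $(a,b,c)$ has degree $k$ if $a,b,c$ are homogeneous of degree $k$. The arrangement $\mathcal{A}$ is free if $D_0(\mathcal{A})$ is a free $S$-module; it is then of rank 2 and the degrees $d_1\le d_2$ of a homogeneous basis are called the exponents of $\mathcal{A}$. Two line arrangements $\mathcal{A},\mathcal{B}$ have the same combinatorics if their intersection lattices $L(\mathcal{A})$ and $L(\mathcal{B})$ are isomorphic. Terao's Conjecture (in this case) says that if $\mathcal{A}$ and $\mathcal{B}$ are two line arrangements in $\mathbb{P}^2$ having the same combinatorics, and if $\mathcal{A}$ is free, then $\mathcal{B}$ is also free. A minimal counter example to Terao's Conjecture is a pair $\mathcal{A},\mathcal{B}$ of line arrangements with the same combinatorics, with $\mathcal{A}$ free, such that Terao's Conjecture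 holds for all pairs $\mathcal{A}',\mathcal{B}'$ (with the same combinatorics) satisfying $|\mathcal{A}'|=|\mathcal{B}'|<|\mathcal{A}|=|\mathcal{B}|$, but not for the pair $\mathcal{A},\mathcal{B}$ (i.e. $\mathcal{B}$ is not free). A multiple point of $\mathcal{A}$ is a point lying on at least two lines of $\mathcal{A}$. *)

(* Defs.v *)
From HB Require Import structures.
From mathcomp Require Import all_boot all_order all_algebra.
From mathcomp Require Import finmap boolp classical_sets functions cardinality.
From mathcomp Require Import reals complex.
From mathcomp Require Import mpoly.

Set Implicit Arguments.
Unset Strict Implicit.
Unset Printing Implicit Defensive.

Import GRing.Theory.
Local Open Scope ring_scope.

Section LineArrangements.
Variable R : realType.

(* Subspaces of P^2 are represented by the corresponding linear subspaces of
   C^3: points have dimension 1 and lines have dimension 2.  A covector [a]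
   encodes the linear form a_0 x + a_1 y + a_2 z. *)
Definition line (a : 'rV[R[i]]_3) : {vspace 'rV[R[i]]_3} :=
  lker (linfun (mulmxr a^T : 'rV[R[i]]_3 -> 'rV[R[i]]_1)).

Definition linear_form (a : 'rV[R[i]]_3) : {mpoly R[i][3]} :=
  \sum_(i < 3) a 0 i *: 'X_i.

(* The lines are given through linear forms defining them.  The order of the
   list and the scaling of the forms are immaterial: they only change the
   product of the forms by a nonzero constant. *)
Record arrangement := Arrangement {
  forms :> seq 'rV[R[i]]_3;
  forms_neq0 : all (fun a => a != 0) forms;
  lines_uniq : uniq [seq line a | a <- forms]
}.

Definition defining_poly (A : arrangement) : {mpoly R[i][3]} :=
  \prod_(a <- A) linear_form a.

Definition D0 (A : arrangement) (v : 'rV[{mpoly R[i][3]}]_3) : Prop :=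
  \sum_(i < 3) v 0 i * (defining_poly A)^`M(i) = 0.

Definition homogeneous (k : nat) (v : 'rV[{mpoly R[i][3]}]_3) : Prop :=
  forall i : 'I_3, v 0 i \is k.-homog.

Definition D0_basis (A : arrangement) (m : nat)
    (e : 'I_m -> 'rV[{mpoly R[i][3]}]_3) : Prop :=
  (forall v, D0 A v <-> exists c : 'I_m -> {mpoly R[i][3]},
                          v = \sum_(i < m) c i *: e i) /\
  (forall c : 'I_m -> {mpoly R[i][3]},
      \sum_(i < m) c i *: e i = 0 -> forall i, c i = 0).

(* Finite bases suffice: D_0 lies in S^3, so a basis has at most 3 elements. *)
Definition free_arr (A : arrangement) : Prop :=
  exists (m : nat) (e : 'I_m -> 'rV[{mpoly R[i][3]}]_3), D0_basis A e.

Definition free_with_exponents (A : arrangement) (d1 d2 : nat) : Prop :=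
  (d1 <= d2)%N /\
  exists e : 'I_2 -> 'rV[{mpoly R[i][3]}]_3,
    [/\ D0_basis A e, homogeneous d1 (e ord0) & homogeneous d2 (e ord_max)].

(* All intersections of lines of A, the empty intersection being the whole
   space.  The zero subspace (the empty subset of P^2) occurs unless all the
   lines pass through one point; it is the top of the lattice. *)
Definition intersection_lattice (A : arrangement)
    : set {vspace 'rV[R[i]]_3} :=
  [set X | exists2 s : seq 'rV[R[i]]_3, {subset s <= forms A} &
             X = (\bigcap_(a <- s) line a)%VS]%classic.

(* An order isomorphism for inclusion is the same as one for the usual reverse
   inclusion, and as an isomorphism of lattices. *)
Definition same_combinatorics (A B : arrangement) : Prop :=
  exists phi : {vspace 'rV[R[i]]_3} -> {vspace 'rV[R[i]]_3},
    set_bij (intersection_lattice A) (intersection_lattice B) phi /\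
    (forall X Y, intersection_lattice A X -> intersection_lattice A Y ->
       (phi X <= phi Y)%VS = (X <= Y)%VS).

Definition terao_holds (A B : arrangement) : Prop :=
  same_combinatorics A B -> free_arr A -> free_arr B.

Definition minimal_counterexample (A B : arrangement) : Prop :=
  [/\ same_combinatorics A B,
      free_arr A,
      ~ free_arr B &
      forall A' B' : arrangement, size A' = size B' ->
        (size A' < size A)%N -> terao_holds A' B'].

Definition multiple_point (A : arrangement) (p : {vspace 'rV[R[i]]_3}) : Prop :=
  \dim p = 1%N /\ (2 <= count (fun a => (p <= line a)%VS) A)%N.

Definition multiple_points_on (A : arrangement) (L : 'rV[R[i]]_3)
    : set {vspace 'rV[R[i]]_3} :=
  [set p | multiple_point A p /\ (p <= line L)%VS]%classic.

(* [fset_set] is junk on infinite sets; see [finite_multiple_points_on]. *)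
Definition num_multiple_points_on (A : arrangement) (L : 'rV[R[i]]_3) : nat :=
  #|` fset_set (multiple_points_on A L)|.

Lemma mem_line (a v : 'rV[R[i]]_3) :
  (v \in line a) = (\sum_(i < 3) a 0 i * v 0 i == 0).
Proof.
have vaE : (v *m a^T) 0 0 = \sum_(i < 3) a 0 i * v 0 i.
  by rewrite mxE; apply: eq_bigr => i _; rewrite mxE mulrC.
rewrite memv_ker lfunE /= -vaE; apply/eqP/eqP => [->|h]; first by rewrite mxE.
by apply/matrixP => i j; rewrite !ord1 h mxE.
Qed.

Lemma dim_line (a : 'rV[R[i]]_3) : a != 0 -> \dim (line a) = 2%N.
Proof.
move=> a0; pose f := linfun (mulmxr a^T : 'rV[R[i]]_3 -> 'rV[R[i]]_1).
have := limg_ker_dim f fullv; rewrite capfv dimvf /dim /=.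
have -> : \dim (f @: fullv) = 1%N.
  apply/eqP; rewrite eqn_leq; apply/andP; split.
    by apply: leq_trans (dimvS (subvf _)) _; rewrite dimvf.
  rewrite lt0n dimv_eq0; apply: contra_neq a0 => f0.
  apply/rowP => i; rewrite [RHS]mxE.
  have : f (delta_mx 0 i) \in (f @: fullv)%VS by rewrite memv_img ?memvf.
  rewrite f0 memv0 lfunE /= => /eqP/matrixP/(_ 0 0).
  by rewrite -rowE !mxE.
by rewrite /line -/f addn1 mul1n => -[].
Qed.

Lemma finite_multiple_points_on (A : arrangement) (L : 'rV[R[i]]_3) :
  L \in forms A -> finite_set (multiple_points_on A L).
Proof.
move=> LA.
apply: (@sub_finite_set _ _
          [set` [seq (line L :&: line b)%VS | b <- A]]%classic); last first.
  exact: finite_seq.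
move=> p [[p1 cp] pL] /=.
have nz b : b \in forms A -> b != 0 by move/(allP (forms_neq0 A)).
have /hasP [b bA /andP[pb bL]] :
    has (fun b => (p <= line b)%VS && (line b != line L)) (forms A).
  apply: contraLR cp; rewrite -all_predC -leqNgt => /allP h.
  apply: (@leq_trans (count_mem (line L) [seq line a | a <- forms A])).
    rewrite count_map -!size_filter; set s1 := filter _ _; set s2 := filter _ _.
    apply: uniq_leq_size; first exact/filter_uniq/map_uniq/lines_uniq.
    move=> b; rewrite !mem_filter => /andP[pb bA]; rewrite bA andbT /=.
    by have := h b bA; rewrite /= pb /= negbK.
  by rewrite count_uniq_mem ?lines_uniq // leq_b1.
apply/mapP; exists b => //; apply/eqP; rewrite eqEdim subv_cap pL pb p1 /=.
have dL := dim_line (nz L LA).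
suff : (\dim (line L :&: line b) < \dim (line L))%N by rewrite dL.
rewrite ltn_neqAle dimvS ?capvSl // andbT.
apply: contra bL => /eqP dE.
have /eqP eL : (line L :&: line b == line L)%VS by rewrite eqEdim capvSl dE /=.
by rewrite eq_sym eqEdim -{1}eL capvSr !dim_line ?nz.
Qed.

End LineArrangements.

(* Main.v *)
Require Import Defs.
From HB Require Import structures.
From mathcomp Require Import all_boot all_order all_algebra.
From mathcomp Require Import finmap boolp classical_sets functions cardinality.
From mathcomp Require Import reals complex.
From mathcomp Require Import mpoly zify ring.

(** Let [A], [B] be a minimal counterexample, and suppose that a line [L] of [A]
    carries [r > d1] multiple points.  Then [A] without [L] is still free, hence,
    by minimality, so is [B] without the corresponding line [L'], and putting
    [L'] back keeps freeness: [B] is free, a contradiction.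

    It is convenient to replace the syzygies by the module [der s] of the
    derivations [th] such that each linear form [l] of the arrangement [s] divides
    [th(l)].  By Euler's formula, [der s] is the direct sum of the syzygies and of
    the multiples of the Euler field, so both modules are free together
    ([der_basis], [syz_basis]).

    Deletion ([deletion]).  On [L], a derivation of [A] is tangent to [L] and
    vanishes, up to a multiple of the Euler field, at the [r] points.  So the
    bivector that it spans with the Euler field, a form of degree [d + 1] on [L]
    if the derivation has degree [d], is divisible by [r] distinct linear forms.
    For the first basis element, [d1 + 1 <= r]: its bivector is either zero or
    proportional to the product [Q] of these forms.  In the second case the
    bivector of the other basis element is a multiple of it; in the first case
    the bivectors form a principal ideal anyway.  In both cases the derivations
    whose bivector vanishes form a free module ([kernel_basis]).  As they are the
    [h * euler + l * eta] with [l] the form of [L] and [eta] a derivation of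
    [A] without [L], the latter derivations form a free module too.

    Exponents.  The derivations of [a :: s] are those of [s] for which [th(a)]
    restricts to zero on the line [a].  The restrictions which occur are the
    multiples of a fixed form of degree [|s| - r], where [r] is the number of
    points on [a]: divisibility is [dvdr_obstruction], and the converse in large
    degree is [obstruction_surj].  This determines the Hilbert function of
    [der (a :: s)] from that of [der s] ([hilbert_cons]).  Hence the Hilbert
    function only depends on the combinatorics in large degree
    ([hilbert_same_incidence]); on the other hand the one of a free module
    determines the exponents.  So [A] without [L] and [B] without [L'] have the
    same exponents, and the comparison of [A] with [A] without [L] shows that
    [|s| - r] is one of them.

    Addition ([addition]).  The basis element of degree [|s| - r] restricts on
    [L'] to a multiple of a form of the same degree, so its restriction is zero or
    divides all the others, and [kernel_basis] applies again.

    The module of syzygies is only given to be free; that it has a homogeneous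
    basis is [homogeneous_basis].  Finally, an isomorphism of intersection
    lattices maps lines to lines and respects incidences ([phi_line],
    [psi_incidence]), and it restricts to the arrangements without [L] and [L']. *)
Set Implicit Arguments.
Unset Strict Implicit.
Unset Printing Implicit Defensive.
Import GRing.Theory Num.Theory.
Local Open Scope ring_scope.

(** * Sequences *)

Lemma uniq_map_injective (T U : eqType) (f : T -> U) (s : seq T) :
  uniq [seq f x | x <- s] -> {in s &, injective f}.
Proof.
elim: s => // x s ih /= /andP[fx us] y z; rewrite !inE.
case/orP=> [/eqP->|ys] /orP[/eqP->|zs] // e; last exact: ih.
  by rewrite e map_f in fx.
by rewrite -e map_f in fx.
Qed.

Lemma size_undup_map (T U V : eqType) (f : T -> U) (g : T -> V) (s : seq T) :
  {in s &, forall x y, (f x == f y) = (g x == g y)} ->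
  size (undup [seq f x | x <- s]) = size (undup [seq g x | x <- s]).
Proof.
elim: s => //= x s ih h.
have -> : (f x \in [seq f y | y <- s]) = (g x \in [seq g y | y <- s]).
  by apply/mapP/mapP => -[y ys /eqP e]; exists y => //; apply/eqP; move: e; rewrite h // !inE ?eqxx ?ys ?orbT.
have {}ih : size (undup [seq f x | x <- s]) = size (undup [seq g x | x <- s]).
  by apply: ih => y z ys zs; apply: h; rewrite inE (ys, zs) orbT.
by case: ifP => _ /=; rewrite ih.
Qed.

Lemma count_perm_cons (T : eqType) (r s : seq T) x (P : pred T) :
  perm_eq r (x :: s) -> P x -> (2 <= count P r)%N = has P s.
Proof. by move=> p Px; rewrite (permP p) /= Px add1n ltnS -has_count. Qed.

(** Each value of [f] is taken once on [t]; the rest [u] repeats values.  With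
    the lines meeting a given line sorted by their intersection point, [t] has
    one line per point, and [u] accounts for the multiplicities. *)
Lemma representatives (T U : eqType) (f : T -> U) (s : seq T) :
  exists t u, [/\ perm_eq s (t ++ u), uniq [seq f x | x <- t],
    {in u, forall x, f x \in [seq f y | y <- t]} &
    size t = size (undup [seq f x | x <- s])].
Proof.
elim: s => [|x s [t [u [p ut hu st]]]]; first by exists [::], [::]; split.
have eqm : [seq f y | y <- s] =i [seq f y | y <- t].
  move=> z; apply/mapP/mapP => -[y]; last first.
    by move=> yt ->; exists y; rewrite // (perm_mem p) mem_cat yt.
  rewrite (perm_mem p) mem_cat => /orP[yt ->|yu ->]; first by exists y.
  by have /mapP[z' zt ->] := hu y yu; exists z'.
case fx: (f x \in [seq f y | y <- s]).
  exists t, (x :: u); split=> //=; rewrite ?fx //.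
    apply: (@perm_trans _ (x :: t ++ u)); first by rewrite perm_cons.
    by rewrite perm_sym; apply/permPl/(perm_catCA t [:: x] u).
  move=> y; rewrite inE => /orP[/eqP->|/hu //].
  by rewrite -eqm.
exists (x :: t), u; split=> //=; rewrite ?fx ?perm_cons //= ?st //.
  by rewrite -eqm fx.
by move=> y /hu; rewrite inE => ->; rewrite orbT.
Qed.

(** * Divisibility in integral domains *)

Definition dvdr (R : idomainType) (p q : R) : Prop := exists r, q = p * r.

Section Dvdr.
Variable R : idomainType.
Implicit Types p q r : R.

Lemma dvdr_mulr p q r : dvdr p q -> dvdr p (q * r).
Proof. by case=> x ->; exists (x * r); rewrite mulrA. Qed.

Lemma dvdr_mull p q r : dvdr p q -> dvdr p (r * q).
Proof. by rewrite mulrC; apply: dvdr_mulr. Qed.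

Lemma dvdrr p : dvdr p p.
Proof. by exists 1; rewrite mulr1. Qed.

Lemma dvdr0 p : dvdr p 0.
Proof. by exists 0; rewrite mulr0. Qed.

Lemma dvdrD p q r : dvdr p q -> dvdr p r -> dvdr p (q + r).
Proof. by case=> x -> [y ->]; exists (x + y); rewrite mulrDr. Qed.

Lemma dvdrN p q : dvdr p q -> dvdr p (- q).
Proof. by case=> x ->; exists (- x); rewrite mulrN. Qed.

Lemma dvdrB p q r : dvdr p q -> dvdr p r -> dvdr p (q - r).
Proof. by move=> h1 h2; apply/dvdrD/dvdrN. Qed.

Lemma dvdr_mul2l p q r : p != 0 -> dvdr (p * q) (p * r) -> dvdr q r.
Proof. by move=> p0 [x]; rewrite -mulrA => /(mulfI p0) ->; exists x. Qed.

End Dvdr.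

(** * Linear forms and restriction to a line *)

Section LinearForms.
Variables (K : fieldType) (n : nat).
Notation S := {mpoly K[n]}.
Implicit Types (a b c : 'rV[K]_n) (F G : S).

Definition lf a : S := \sum_(i < n) a 0 i *: 'X_i.

Lemma lfE a b x y : lf (x *: a + y *: b) = x *: lf a + y *: lf b.
Proof.
rewrite /lf !scaler_sumr -big_split /=; apply: eq_bigr => i _.
by rewrite !mxE scalerDl !scalerA.
Qed.

Lemma lfZ x a : lf (x *: a) = x *: lf a.
Proof. by have := lfE a 0 x 0; rewrite scale0r addr0 scale0r addr0. Qed.

Lemma lf_homog a : lf a \is 1.-homog.
Proof. by apply: rpred_sum => i _; apply: rpredZ; rewrite dhomogX /= mdeg1. Qed.

Lemma lf_coeff a i : (lf a)@_U_(i) = a 0 i.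
Proof.
rewrite raddf_sum /= (bigD1 i) //= mcoeffZ mcoeffX eqxx mulr1 big1 ?addr0 //.
move=> j ji; rewrite mcoeffZ mcoeffX; case: eqP; rewrite ?mulr0 //.
by move/(congr1 (fun m : 'X_{1..n} => m i)); rewrite !mnm1E eqxx (negbTE ji).
Qed.

Lemma lf_inj : injective lf.
Proof. by move=> a b h; apply/rowP => i; rewrite -!lf_coeff h. Qed.

Lemma lf_eq0 a : (lf a == 0) = (a == 0).
Proof.
apply/eqP/eqP => [h|->]; last by rewrite /lf big1 // => i _; rewrite mxE scale0r.
by apply/rowP => i; rewrite -lf_coeff h mcoeff0 mxE.
Qed.

Lemma lf_delta i : lf (delta_mx 0 i) = 'X_i.
Proof.
rewrite /lf (bigD1 i) //= big1 ?addr0 => [|j ji]; rewrite !mxE !eqxx /= ?scale1r //.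
by rewrite (negbTE ji) scale0r.
Qed.

(** A coordinate vector outside the plane [a = 0], scaled so that [a] takes
    the value 1 on it. *)
Definition transversal a : 'I_n -> K :=
  fun i => if [pick j | a 0 j != 0] is Some j then (a 0 j)^-1 *+ (i == j) else 0.

Lemma transversalP a : a != 0 -> \sum_i a 0 i * transversal a i = 1.
Proof.
move=> a0; rewrite /transversal; case: pickP => [j aj|h].
  rewrite (bigD1 j) //= eqxx divff // big1 ?addr0 // => i ij.
  by rewrite (negbTE ij) mulr0.
case/eqP: a0; apply/rowP => j; apply/eqP; rewrite mxE.
by move: (h j) => /negbT; rewrite negbK.
Qed.

(** Restriction to the hyperplane [a = 0]: composition with the projection
    onto it along [transversal a].  Its image is a copy of [S / (a)] inside
    [S], so that computations modulo [a] take place in the domain [S]. *)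
Definition restr a : S -> S :=
  comp_mpoly [tuple 'X_i - transversal a i *: lf a | i < n].

HB.instance Definition _ a := GRing.RMorphism.on (restr a).
HB.instance Definition _ a := GRing.Linear.on (restr a).

Lemma restrX a i : restr a 'X_i = 'X_i - transversal a i *: lf a.
Proof. by rewrite /restr comp_mpolyXU -tnth_nth tnth_mktuple. Qed.

Lemma restr_lf a : a != 0 -> restr a (lf a) = 0.
Proof.
move=> a0; rewrite [X in restr a X]/lf linear_sum /=.
under eq_bigr => i _ do rewrite linearZ /= restrX scalerBr scalerA.
by rewrite sumrB -scaler_suml transversalP // scale1r subrr.
Qed.

(** The property holds for the variables and is compatible with sums and
    products. *)
Lemma restr_sub a F : dvdr (lf a) (F - restr a F).
Proof.
elim/mpolyind: F => [|c m F _ _ ih]; first by rewrite linear0 subrr; apply: dvdr0.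
rewrite linearP /= opprD addrACA; apply: dvdrD => //.
rewrite -scalerBr -mul_mpolyC; apply: dvdr_mull => {F ih c}.
rewrite mpolyXE_id rmorph_prod /=.
apply: (big_ind2 (fun p q => dvdr (lf a) (p - q))) => [|x y z t h1 h2|i _].
- by rewrite subrr; apply: dvdr0.
- have -> : x * z - y * t = (x - y) * z + y * (z - t).
    by rewrite mulrBl mulrBr addrA subrK.
  by apply: dvdrD; [apply: dvdr_mulr | apply: dvdr_mull].
elim: (m i) => [|k ih]; first by rewrite !expr0 rmorph1 subrr; apply: dvdr0.
rewrite !exprS rmorphM /= restrX mulrBl opprB addrA addrAC -mulrBr.
apply: dvdrD; first exact: dvdr_mull.
by apply: dvdr_mulr; rewrite -mul_mpolyC; apply/dvdr_mull/dvdrr.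
Qed.

Lemma restr_eq0 a F : a != 0 -> restr a F = 0 <-> dvdr (lf a) F.
Proof.
move=> a0; split=> [h|[G ->]]; last by rewrite rmorphM /= restr_lf // mul0r.
by have := restr_sub a F; rewrite h subr0.
Qed.

Lemma restrK a F : a != 0 -> restr a (restr a F) = restr a F.
Proof.
move=> a0; apply/eqP; rewrite -subr_eq0 -linearB /= -oppr_eq0 -linearN opprB.
by apply/eqP/restr_eq0/restr_sub.
Qed.

Lemma restr_homog a d F : F \is d.-homog -> restr a F \is d.-homog.
Proof.
have hX i : restr a 'X_i \is 1.-homog.
  rewrite restrX rpredB ?dhomogX /= ?mdeg1 //.
  by apply: rpredZ; apply: lf_homog.
move=> hF; rewrite [F]mpolyE linear_sum /= big_seq; apply: rpred_sum => m mF.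
rewrite linearZ /=; apply: rpredZ; have <- := dhomog_mf hF mF.
rewrite mpolyXE_id rmorph_prod /= mdegE.
elim/big_rec2: _ => [|i d' p _ hp]; first exact: dhomog1.
apply: dhomogM => //; rewrite rmorphXn /= -[X in X.-homog]mul1n.
exact: dhomogMn.
Qed.

Lemma restr_pihomog a d F :
  restr a (pihomog mdeg d F) = pihomog mdeg d (restr a F).
Proof.
elim/mpolyind: F => [|c m F _ _ ih]; first by rewrite !linear0.
rewrite !linearP /= ih; congr (_ *: _ + _).
have hm : 'X_[K, m] \is (mdeg m).-homog by rewrite dhomogX.
have [<-|ne] := eqVneq (mdeg m) d.
  by rewrite !pihomog_dE // restr_homog.
by rewrite !(pihomog_ne0 ne) ?linear0 // restr_homog.
Qed.

Lemma pihomogM d e F G :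
  F \is d.-homog -> pihomog mdeg (d + e) (F * G) = F * pihomog mdeg e G.
Proof.
move=> hF; elim/mpolyind: G => [|c m G _ _ ih]; first by rewrite mulr0 !linear0 mulr0.
rewrite mulrDr -scalerAr !linearP /= ih mulrDr -scalerAr; congr (_ *: _ + _).
have hm : 'X_[K, m] \is (mdeg m).-homog by rewrite dhomogX.
have hFm := dhomogM hF hm.
have [<-|ne] := eqVneq (mdeg m) e; first by rewrite !pihomog_dE.
by rewrite !(@pihomog_ne0 _ _ _ _ _ _ _ hFm) ?(@pihomog_ne0 _ _ _ _ _ _ _ hm) ?mulr0 // eqn_add2l.
Qed.

Lemma pihomogM_lt d e F G :
  F \is d.-homog -> (e < d)%N -> pihomog mdeg e (F * G) = 0.
Proof.
move=> hF lt; elim/mpolyind: G => [|c m G _ _ ih]; first by rewrite mulr0 !linear0.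
rewrite mulrDr -scalerAr linearP /= ih addr0.
have hm : 'X_[K, m] \is (mdeg m).-homog by rewrite dhomogX.
rewrite (@pihomog_ne0 _ _ _ _ _ _ _ (dhomogM hF hm)) ?scaler0 //.
by rewrite gtn_eqF // (leq_trans lt) // leq_addr.
Qed.

(** Linear forms are prime: modulo [lf a] one computes in a domain. *)
Lemma lf_prime a F G :
  a != 0 -> dvdr (lf a) (F * G) -> dvdr (lf a) F \/ dvdr (lf a) G.
Proof.
move=> a0 /(restr_eq0 _ a0) /eqP; rewrite rmorphM mulf_eq0 => /orP[]/eqP h.
  by left; apply/restr_eq0.
by right; apply/restr_eq0.
Qed.

Lemma restr_lfE a b : restr a (lf b) = lf (b - (\sum_i b 0 i * transversal a i) *: a).
Proof.
rewrite [X in restr a X]/lf linear_sum /=.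
under eq_bigr => i _ do rewrite linearZ /= restrX scalerBr scalerA.
rewrite sumrB -scaler_suml -{1}/(lf b).
by have := lfE b a 1 (- \sum_i b 0 i * transversal a i); rewrite !scale1r !scaleNr.
Qed.

Lemma restr_lf_eq0 a b : a != 0 -> (restr a (lf b) == 0) = (b <= a)%MS.
Proof.
move=> a0; apply/eqP/sub_rVP => [|[x ->]].
  move/eqP; rewrite restr_lfE lf_eq0 subr_eq0 => /eqP.
  by exists (\sum_i b 0 i * transversal a i).
by rewrite lfZ linearZ /= restr_lf // scaler0.
Qed.

End LinearForms.

(** * Products of linear forms *)

Section LinearFormsProducts.
Variables (K : fieldType) (n : nat).
Notation S := {mpoly K[n]}.
Implicit Types (a b c : 'rV[K]_n) (F G P : S) (s t u v : seq 'rV[K]_n).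

Definition distinct_lines s : Prop :=
  [/\ uniq s, {in s, forall b, b != 0} & {in s &, forall b c, (c <= b)%MS -> c = b}].

Lemma submx_rV_sym a b : b != 0 -> (b <= a)%MS -> (a <= b)%MS.
Proof.
move=> b0 /sub_rVP[x eb]; apply/sub_rVP; exists x^-1; rewrite eb scalerA mulVf ?scale1r //.
by apply: contra_neq b0 => x0; rewrite eb x0 scale0r.
Qed.

Lemma dvdr_lf_prod c u :
  c != 0 -> dvdr (lf c) (\prod_(b <- u) lf b) -> exists2 b, b \in u & (b <= c)%MS.
Proof.
move=> c0; elim: u => [|b u ih].
  rewrite big_nil => /(restr_eq0 _ c0); rewrite rmorph1 => /eqP.
  by rewrite oner_eq0.
rewrite big_cons => /(lf_prime c0)[].
  move/(restr_eq0 _ c0)/eqP; rewrite restr_lf_eq0 // => h.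
  by exists b; rewrite ?mem_head.
by case/ih => d du dc; exists d; rewrite // inE du orbT.
Qed.

(** The factors on the left are prime, so they can be cancelled one by one. *)
Lemma dvdr_prod_coprime v P F :
  {in v, forall c, c != 0 /\ ~ dvdr (lf c) P} ->
  dvdr (\prod_(c <- v) lf c) (P * F) -> dvdr (\prod_(c <- v) lf c) F.
Proof.
elim: v F => [|c v ih] F hv; first by rewrite big_nil => _; exists F; rewrite mul1r.
have [c0 cP] := hv c (mem_head _ _).
rewrite big_cons => -[G]; rewrite -mulrA => eG.
have [//|[F' eF]] : dvdr (lf c) P \/ dvdr (lf c) F.
  by apply: lf_prime => //; rewrite eG; apply/dvdr_mulr/dvdrr.
rewrite eF; suff [H ->] : dvdr (\prod_(c <- v) lf c) F'.
  by exists H; rewrite mulrA.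
apply: ih => [d dv|]; first by apply: hv; rewrite inE dv orbT.
exists G; move: eG; rewrite eF mulrCA; apply: mulfI.
by rewrite lf_eq0.
Qed.

(** Non proportional forms are coprime, so it suffices to treat, for each line,
    the product of the forms of the list which define that line. *)
Lemma dvdr_prod_classes u F :
  {in u, forall b, b != 0} ->
  {in u, forall b, dvdr (\prod_(c <- u | (c <= b)%MS) lf c) F} ->
  dvdr (\prod_(c <- u) lf c) F.
Proof.
have [N] := ubnP (size u); elim: N u F => // N ih [|b u] F ltN u0 hu.
  by rewrite big_nil; exists F; rewrite mul1r.
set v := b :: u in ltN u0 hu *.
rewrite (bigID (fun c => (c <= b)%MS)) /=.
have bv : b \in v by rewrite mem_head.
have [G eG] := hu b bv.
set u2 := [seq c <- v | ~~ (c <= b)%MS].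
rewrite -[X in dvdr (_ * X)]big_filter -/u2 {1}eG.
suff [H ->] : dvdr (\prod_(c <- u2) lf c) G by exists H; rewrite mulrA.
have u2v c : c \in u2 -> c \in v by rewrite mem_filter => /andP[].
apply: ih => [|c /u2v/u0 //|c cu2].
  rewrite ltnS in ltN; apply: leq_trans ltN; rewrite size_filter /= submx_refl /=.
  by rewrite add0n ltnS count_size.
have c0 := u0 c (u2v c cu2).
have ncb : ~~ (c <= b)%MS by move: cu2; rewrite mem_filter => /andP[].
have : dvdr (\prod_(d <- v | (d <= c)%MS) lf d) F by apply/hu/u2v.
have -> : \prod_(d <- u2 | (d <= c)%MS) lf d = \prod_(d <- v | (d <= c)%MS) lf d.
  rewrite big_filter_cond big_seq_cond [RHS]big_seq_cond; apply: eq_bigl => d.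
  case dv: (d \in v) => //=; case dc: (d <= c)%MS; rewrite ?andbF // andbT.
  by apply: contraNN ncb => db; apply: submx_trans (submx_rV_sym (u0 d dv) dc) db.
rewrite eG -!(big_filter v); set P := \prod_(c <- [seq _ <- v | (_ <= b)%MS]) _.
apply: dvdr_prod_coprime => d; rewrite mem_filter => /andP[dc dv].
split; first exact: u0.
case/(dvdr_lf_prod (u0 d dv)) => e; rewrite mem_filter => /andP[eb ev] ed.
case/negP: ncb; apply: submx_trans (submx_rV_sym (u0 d dv) dc) _.
exact: submx_trans (submx_rV_sym (u0 e ev) ed) eb.
Qed.

Lemma dvdr_prod_distinct u F :
  distinct_lines u -> {in u, forall b, dvdr (lf b) F} -> dvdr (\prod_(c <- u) lf c) F.
Proof.
case=> uu u0 du hu; apply: dvdr_prod_classes => // b bu.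
rewrite -big_filter (_ : filter _ u = [:: b]) ?big_seq1; first exact: hu.
rewrite -(filter_pred1_uniq uu bu); apply: eq_in_filter => c cu /=.
by apply/idP/eqP => [|->//]; apply: du.
Qed.

Lemma prod_lf_homog u : \prod_(c <- u) lf c \is (size u).-homog.
Proof.
elim: u => [|b u ih]; first by rewrite big_nil dhomog1.
rewrite big_cons; exact: (dhomogM (lf_homog b) ih).
Qed.

Lemma prod_lf_neq0 u : {in u, forall b, b != 0} -> \prod_(c <- u) lf c != 0.
Proof.
by move=> u0; rewrite prodf_seq_neq0; apply/allP => c cu /=; rewrite lf_eq0 u0.
Qed.

Lemma perm_distinct s t :
  perm_eq s t -> distinct_lines s -> distinct_lines t.
Proof.
move=> p [us s0 ds]; split; first by rewrite -(perm_uniq p).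
  by move=> b; rewrite -(perm_mem p); apply: s0.
by move=> b c; rewrite -!(perm_mem p); apply: ds.
Qed.

(** ** The points of a line *)

(** The covector of the restriction of [lf b] to the line [a]. *)
Definition trace_on a b : 'rV[K]_n := b - (\sum_i b 0 i * transversal a i) *: a.

Lemma restr_lf_trace a b : restr a (lf b) = lf (trace_on a b).
Proof. exact: restr_lfE. Qed.

Lemma trace_on_eq0 a b : a != 0 -> (trace_on a b == 0) = (b <= a)%MS.
Proof. by move=> a0; rewrite -lf_eq0 -restr_lf_trace restr_lf_eq0. Qed.

Lemma trace_on_lin a x b c y :
  trace_on a (x *: b + y *: c) = x *: trace_on a b + y *: trace_on a c.
Proof.
by apply: lf_inj; rewrite lfE -!restr_lf_trace lfE linearD !linearZ.
Qed.

Lemma trace_on_sub a b c : a != 0 -> ~~ (c <= a)%MS ->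
  (trace_on a c <= trace_on a b)%MS = (c <= a + b)%MS.
Proof.
move=> a0 ca; apply/sub_rVP/sub_addsmxP => [[x]|[[u v] /=]].
  rewrite /trace_on => /eqP; rewrite subr_eq => /eqP ->.
  exists ((- x * (\sum_i b 0 i * transversal a i) + \sum_i c 0 i * transversal a i)%:M, x%:M).
  by rewrite /= !mul_scalar_mx scalerDl mulNr scaleNr scalerBr scalerA -addrA addrC.
rewrite [u]mx11_scalar [v]mx11_scalar !mul_scalar_mx => ->.
exists (v 0 0); rewrite trace_on_lin.
by have /eqP -> : trace_on a a == 0; rewrite ?trace_on_eq0 // scaler0 add0r.
Qed.

(** The point where the line [b] meets the line [a], encoded by the pencil
    of all lines through it. *)
Definition pencil a b : 'M[K]_n := genmx (a + b)%MS.

Lemma pencil_eq a b c : a != 0 -> ~~ (b <= a)%MS -> ~~ (c <= a)%MS ->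
  (pencil a c == pencil a b) = (trace_on a c <= trace_on a b)%MS.
Proof.
move=> a0 ba ca; rewrite /pencil; apply/eqP/idP => [/genmxP/andP[h _]|h].
  by rewrite trace_on_sub //; move: h; rewrite addsmx_sub => /andP[].
apply/genmxP; rewrite !addsmx_sub !addsmxSl /= -!trace_on_sub // h /=.
by apply: submx_rV_sym => //; rewrite trace_on_eq0.
Qed.

Definition npoints a s : nat := size (undup [seq pencil a b | b <- s]).

End LinearFormsProducts.

(** * Logarithmic derivations *)

Section Derivations.
Variables (K : fieldType) (n : nat).
Notation S := {mpoly K[n]}.
Notation V := 'rV[S]_n.
Implicit Types (a b c : 'rV[K]_n) (F G P : S) (s t u v : seq 'rV[K]_n) (th : V).

(** The value on the linear form [lf a] of the derivation with coefficients [th]. *)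
Definition ev a th : S := \sum_(i < n) a 0 i *: th 0 i.

Lemma evD a th th' : ev a (th + th') = ev a th + ev a th'.
Proof. by rewrite -big_split; apply: eq_bigr => i _; rewrite mxE scalerDr. Qed.

Lemma evZ a F th : ev a (F *: th) = F * ev a th.
Proof. by rewrite mulr_sumr; apply: eq_bigr => i _; rewrite mxE scalerAr. Qed.

Lemma ev0 a : ev a 0 = 0.
Proof. by rewrite /ev big1 // => i _; rewrite mxE scaler0. Qed.

Lemma evN a th : ev a (- th) = - ev a th.
Proof. by rewrite -scaleN1r evZ mulN1r. Qed.

Lemma evB a th th' : ev a (th - th') = ev a th - ev a th'.
Proof. by rewrite evD evN. Qed.

Lemma ev_lin x a y b th : ev (x *: a + y *: b) th = x *: ev a th + y *: ev b th.
Proof.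
rewrite /ev !scaler_sumr -big_split /=; apply: eq_bigr => i _.
by rewrite !mxE scalerDl !scalerA.
Qed.

Lemma ev_delta i th : ev (delta_mx 0 i) th = th 0 i.
Proof.
rewrite /ev (bigD1 i) //= big1 ?addr0 => [|j ji]; rewrite !mxE !eqxx ?scale1r //=.
by rewrite (negbTE ji) scale0r.
Qed.

Definition vhomog d th : Prop := forall i, th 0 i \is d.-homog.

Definition vpi d th : V := \row_i pihomog mdeg d (th 0 i).

Lemma vpi_homog d th : vhomog d (vpi d th).
Proof. by move=> i; rewrite mxE; apply: pihomogP. Qed.

Lemma ev_vpi a d th : ev a (vpi d th) = pihomog mdeg d (ev a th).
Proof. by rewrite linear_sum /=; apply: eq_bigr => i _; rewrite linearZ /= mxE. Qed.

Lemma ev_homog a d th : vhomog d th -> ev a th \is d.-homog.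
Proof. by move=> h; apply: rpred_sum => i _; apply/rpredZ/h. Qed.

Lemma vpi_id d th : vhomog d th -> vpi d th = th.
Proof. by move=> h; apply/rowP => i; rewrite mxE; apply/pihomog_dE/h. Qed.

Lemma vpiD d th th' : vpi d (th + th') = vpi d th + vpi d th'.
Proof. by apply/rowP => i; rewrite !mxE linearD. Qed.

Lemma vpi0 d : vpi d 0 = 0.
Proof. by apply/rowP => i; rewrite !mxE linear0. Qed.

Lemma vpi_sum d (I : Type) (r : seq I) (P : pred I) (f : I -> V) :
  vpi d (\sum_(i <- r | P i) f i) = \sum_(i <- r | P i) vpi d (f i).
Proof. by apply: big_morph; [apply: vpiD | apply: vpi0]. Qed.

Lemma vhomogZ d e F th : F \is d.-homog -> vhomog e th -> vhomog (d + e) (F *: th).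
Proof. by move=> hF ht i; rewrite mxE; apply: dhomogM. Qed.

Lemma vhomogD d th th' : vhomog d th -> vhomog d th' -> vhomog d (th + th').
Proof. by move=> h h' i; rewrite mxE; apply: rpredD. Qed.

Lemma vhomogN d th : vhomog d th -> vhomog d (- th).
Proof. by move=> h i; rewrite mxE rpredN. Qed.

Lemma vpiZ d e F th : vhomog e th ->
  vpi (e + d) (F *: th) = pihomog mdeg d F *: th.
Proof.
by move=> h; apply/rowP => i; rewrite !mxE mulrC (pihomogM _ _ (h i)) mulrC.
Qed.

Lemma vpiZ_lt d e F th : vhomog e th -> (d < e)%N -> vpi d (F *: th) = 0.
Proof.
by move=> h lt; apply/rowP => i; rewrite !mxE mulrC (pihomogM_lt _ (h i) lt).
Qed.

(** The module of logarithmic derivations of the lines of [s]. *)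
Definition der s th : Prop := {in s, forall b, dvdr (lf b) (ev b th)}.

Lemma derD s th th' : der s th -> der s th' -> der s (th + th').
Proof. by move=> h h' b bs; rewrite evD; apply: dvdrD; [apply: h | apply: h']. Qed.

Lemma derZ s F th : der s th -> der s (F *: th).
Proof. by move=> h b bs; rewrite evZ; apply/dvdr_mull/h. Qed.

Lemma der_vpi s d th : {in s, forall b, b != 0} -> der s th -> der s (vpi d th).
Proof.
move=> s0 h b bs; rewrite ev_vpi; apply/restr_eq0; first exact: s0.
by rewrite restr_pihomog (restr_eq0 _ (s0 b bs)).2 ?linear0 //; apply: h.
Qed.

Definition euler : V := \row_i 'X_i.

Lemma ev_euler a : ev a euler = lf a.
Proof. by apply: eq_bigr => i _; rewrite mxE. Qed.

Lemma der_euler s : der s euler.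
Proof. by move=> b _; rewrite ev_euler; apply: dvdrr. Qed.

Lemma euler_homog : vhomog 1 euler.
Proof. by move=> i; rewrite mxE dhomogX /= mdeg1. Qed.

(** ** Adding a line *)

(** Sending [th] to the restriction to the line [a] of [th(a)] is a map of
    [der s] whose kernel is [der (a :: s)]. *)
Definition obstruction a th : S := restr a (ev a th).

Lemma der_cons a s th : a != 0 ->
  der (a :: s) th <-> der s th /\ obstruction a th = 0.
Proof.
move=> a0; split=> [h|[h o] b].
  split; first by move=> b bs; apply: h; rewrite inE bs orbT.
  by apply/restr_eq0 => //; apply: h; rewrite mem_head.
by rewrite inE => /orP[/eqP ->|/h //]; apply/restr_eq0.
Qed.

Lemma obstructionD a th th' : obstruction a (th + th') = obstruction a th + obstruction a th'.
Proof. by rewrite /obstruction evD linearD. Qed.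

Lemma obstructionZ a F th : obstruction a (F *: th) = restr a F * obstruction a th.
Proof. by rewrite /obstruction evZ rmorphM. Qed.

Lemma obstruction_euler a : a != 0 -> obstruction a euler = 0.
Proof. by move=> a0; rewrite /obstruction ev_euler restr_lf. Qed.

(** The bivector [lf a * th(b) - lf b * th(a)] only depends, up to scaling, on
    the pencil spanned by [a] and [b], hence is divisible by every form of that
    pencil which [th] preserves; restricting it to [a] leaves
    [- lf b * th(a)]. *)
Lemma pencil_dvdr_obstruction a b s th :
  a != 0 -> distinct_lines s -> {in s, forall c, ~~ (c <= a)%MS} ->
  b \in s -> der s th ->
  dvdr (\prod_(c <- s | (trace_on a c <= trace_on a b)%MS) lf (trace_on a c))
       (lf (trace_on a b) * obstruction a th).
Proof.
move=> a0 [us s0 ds] sa bs hth.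
pose w := lf a * ev b th - lf b * ev a th.
pose cs := [seq c <- s | (trace_on a c <= trace_on a b)%MS].
have [|b' b's|h ew] := @dvdr_prod_distinct _ _ cs w.
- split; first exact: filter_uniq.
    by move=> c; rewrite mem_filter => /andP[_]; apply: s0.
  by move=> c d; rewrite !mem_filter => /andP[_ +] /andP[_]; apply: ds.
- move: b's; rewrite mem_filter => /andP[cb cs'].
  rewrite trace_on_sub ?sa // in cb; case/sub_addsmxP: cb => -[x y] /= eb'.
  rewrite [x]mx11_scalar [y]mx11_scalar !mul_scalar_mx in eb'.
  set x' := x 0 0 in eb'; set y' := y 0 0 in eb'.
  have y0 : y' != 0.
    by apply: contraNneq (sa _ cs') => y0; rewrite eb' y0 scale0r addr0 scalemx_sub.
  have -> : w = y'^-1 *: (lf a * ev b' th - lf b' * ev a th).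
    rewrite eb' lfE ev_lin mulrDr mulrDl -!scalerAr -!scalerAl opprD addrACA subrr add0r.
    by rewrite -scalerBr scalerA mulVf // scale1r.
  rewrite -mul_mpolyC; apply/dvdr_mull/dvdrB; first by apply/dvdr_mull/hth.
  by apply/dvdr_mulr/dvdrr.
exists (- restr a h); rewrite -[RHS]opprK mulrN opprK.
have := congr1 (restr a) ew; rewrite /w linearB /= !rmorphM /= restr_lf // mul0r sub0r.
rewrite restr_lf_trace rmorph_prod /= big_filter => /(congr1 -%R); rewrite opprK => ->.
by congr (- (_ * _)); apply: eq_bigr => c _; rewrite restr_lf_trace.
Qed.

(** At a point of [a] on [m] lines of [s], the pencil lemma makes [m - 1] of their
    forms divide the obstruction, one being cancelled; distinct points
    contribute coprime factors. *)
Lemma dvdr_obstruction a s t u th :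
  a != 0 -> distinct_lines s -> {in s, forall c, ~~ (c <= a)%MS} ->
  perm_eq s (t ++ u) -> {in u, forall c, pencil a c \in [seq pencil a d | d <- t]} ->
  der s th -> dvdr (\prod_(c <- u) lf (trace_on a c)) (obstruction a th).
Proof.
move=> a0 hs sa p hu hth; have [us s0 ds] := hs.
have us' c : c \in u -> c \in s by move=> cu; rewrite (perm_mem p) mem_cat cu orbT.
have ts' c : c \in t -> c \in s by move=> ct; rewrite (perm_mem p) mem_cat ct.
have tr0 c : c \in s -> trace_on a c != 0 by move=> cs; rewrite trace_on_eq0 // sa.
have -> : \prod_(c <- u) lf (trace_on a c) = \prod_(c <- [seq trace_on a d | d <- u]) lf c.
  by rewrite big_map.
apply: dvdr_prod_classes => _ /mapP[c cu ->]; first by apply/tr0/us'.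
rewrite big_map; have [b bt /eqP] := mapP (hu c cu).
have [bs cs] := (ts' b bt, us' c cu).
rewrite pencil_eq ?sa // => cb; have bc := submx_rV_sym (tr0 c cs) cb.
have := pencil_dvdr_obstruction a0 hs sa bs hth.
rewrite (perm_big _ p) big_cat /= (big_rem b) //= submx_refl -!mulrA.
have b0 : lf (trace_on a b) != 0 by rewrite lf_eq0 tr0.
move/(dvdr_mul2l b0); rewrite mulrC.
have -> : \prod_(j <- u | (trace_on a j <= trace_on a b)%MS) lf (trace_on a j)
        = \prod_(j <- u | (trace_on a j <= trace_on a c)%MS) lf (trace_on a j).
  apply: eq_bigl => d; apply/idP/idP => h; exact: submx_trans h _.
by case=> x ->; rewrite -mulrA; apply/dvdr_mulr/dvdrr.
Qed.

(** Such fields provide derivations which preserve [b] but not [a]. *)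
Lemma transversal_along a b : b != 0 -> ~~ (a <= b)%MS ->
  exists v : V, [/\ vhomog 0 v, ev b v = 0 & ev a v = 1].
Proof.
move=> b0 ab.
have a'0 : trace_on b a != 0 by rewrite trace_on_eq0.
pose w := transversal (trace_on b a).
pose v i := w i - (\sum_j b 0 j * w j) * transversal b i.
exists (\row_i (v i)%:MP); split=> [i||].
- by rewrite mxE -[_%:MP]mul1r mulrC mul_mpolyC; apply/rpredZ/dhomog1.
- rewrite /ev; under eq_bigr => i _ do rewrite mxE -mul_mpolyC -mpolyCM.
  rewrite -raddf_sum /= (_ : \sum_i _ = 0) ?mpolyC0 //.
  under eq_bigr => i _ do rewrite /v mulrBr mulrCA.
  by rewrite sumrB -mulr_sumr transversalP // mulr1 subrr.
rewrite /ev; under eq_bigr => i _ do rewrite mxE -mul_mpolyC -mpolyCM.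
rewrite -raddf_sum /= (_ : \sum_i _ = 1) //.
rewrite -[RHS](transversalP a'0).
under eq_bigr => i _ do rewrite /v mulrBr mulrCA.
under [RHS]eq_bigr => i _ do rewrite /trace_on !mxE mulrBl -mulrA.
by rewrite !sumrB -!mulr_sumr mulrC.
Qed.

End Derivations.

(** ** The values of the obstruction *)

Section Interpolation.
Variable K : fieldType.
Notation S := {mpoly K[3]}.
Notation V := 'rV[S]_3.
Implicit Types (a b c : 'rV[K]_3) (F G P : S) (s t u v : seq 'rV[K]_3) (th : V).

Lemma rank_adds_rV m (A : 'M[K]_(m, 3)) c : ~~ (c <= A)%MS ->
  (\rank A < \rank (A + c)%MS)%N.
Proof.
move=> cA; rewrite ltn_neqAle mxrankS ?addsmxSl // andbT.
apply: contraNneq cA => /eqP; rewrite mxrank_leqif_sup ?addsmxSl // addsmx_sub.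
by case/andP.
Qed.

Lemma mem_span3 a b c d : a != 0 -> ~~ (b <= a)%MS -> ~~ (c <= a + b)%MS ->
  exists x y z, d = x *: a + y *: b + z *: c.
Proof.
move=> a0 ba ca.
have /submx_full h : row_full (a + b + c)%MS.
  rewrite /row_full eqn_leq rank_leq_col /=.
  apply: leq_trans (rank_adds_rV ca); rewrite ltnS.
  by apply: leq_trans (rank_adds_rV ba); rewrite ltnS rank_rV a0.
have /sub_addsmxP[[u v] /= ->] := h _ d.
have /sub_addsmxP[[u' v'] /= ->] := submxMl u (a + b)%MS.
exists (u' 0 0), (v' 0 0), (v 0 0).
by rewrite {1}[u']mx11_scalar {1}[v']mx11_scalar {1}[v]mx11_scalar !mul_scalar_mx.
Qed.

(** By induction on the number of forms: a variable is a combination of [a] and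
    of two of the forms, and the ideal quotient by each of these two satisfies
    the hypothesis for the remaining forms. *)
Lemma lagrange_ideal (I : S -> Prop) a t (m : 'X_{1..3}) :
  a != 0 -> t != [::] -> {in t, forall b, ~~ (b <= a)%MS} ->
  uniq [seq pencil a b | b <- t] ->
  (forall F G, I F -> I G -> I (F + G)) -> (forall F G, I G -> I (F * G)) ->
  I (lf a) ->
  {in t, forall b Q, lf b * Q = \prod_(c <- t) lf c -> I Q} ->
  (size t <= (mdeg m).+1)%N -> I 'X_[m].
Proof.
move=> a0; have [N] := ubnP (size t).
elim: N t m I => // N ih [//|b [|c t]] m I ltN _ ta ut hD hM Ia hI szm.
  rewrite -['X_[m]]mulr1; apply: hM; apply: (hI b); rewrite ?mem_head //.
  by rewrite big_seq1 mulr1.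
have [bt ct] : b \in [:: b, c & t] /\ c \in [:: b, c & t] by rewrite !inE !eqxx orbT.
have [k mk] : exists k, (0 < m k)%N.
  apply/existsP; rewrite -[[exists k, _]]negbK negb_exists; apply/forallP => h.
  move: szm; rewrite mdegE big1 // => i _.
  by apply/eqP; rewrite -leqn0 leqNgt.
pose m' := (m - U_(k))%MM.
have em : m = (m' + U_(k))%MM by rewrite submK // lep1mP -lt0n.
have szm' : (size t <= mdeg m')%N.
  by move: szm; rewrite {1}em mdegD mdeg1 addn1.
have ncab : ~~ (c <= a + b)%MS.
  move: ut => /= /andP[+ _]; rewrite inE negb_or => /andP[+ _].
  by rewrite eq_sym pencil_eq ?ta // trace_on_sub // ta.
have [x [y [z ek]]] := mem_span3 (delta_mx 0 k) a0 (ta b bt) ncab.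
have -> : 'X_[K, m] = x *: ('X_[m'] * lf a) + y *: (lf b * 'X_[m']) + z *: (lf c * 'X_[m']).
  rewrite em mpolyXD -lf_delta ek -[_ + z *: c]scale1r -[x *: a + y *: b]scale1r.
  rewrite scale1r lfE scale1r lfE mulrDr mulrDr -!scalerAr.
  by rewrite -![_ * 'X_[m']]mulrC.
have hZ w G : I G -> I (w *: G) by rewrite -mul_mpolyC; apply: hM.
apply: (hD); first apply: (hD); apply: (hZ); first exact: hM.
- apply: (ih (c :: t) m' (fun F => I (lf b * F))) => //.
  + by move=> d dt; apply: ta; rewrite inE dt orbT.
  + by move: ut; rewrite map_cons cons_uniq => /andP[].
  + by move=> F G IF IG; rewrite mulrDr; apply: hD.
  + by move=> F G IG; rewrite mulrCA; apply: hM.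
  + exact: hM.
  move=> d dt Q eQ; apply: (hI d); first by rewrite inE dt orbT.
  by rewrite mulrCA eQ [RHS]big_cons.
- apply: (ih (b :: t) m' (fun F => I (lf c * F))) => //.
  + by move=> d; rewrite inE => dt; apply: ta; rewrite !inE; case/orP: dt => ->; rewrite ?orbT.
  + by move: ut => /= /andP[]; rewrite inE negb_or => /andP[_ ->] /andP[_ ->].
  + by move=> F G IF IG; rewrite mulrDr; apply: hD.
  + by move=> F G IG; rewrite mulrCA; apply: hM.
  + exact: hM.
  move=> d dt Q eQ; apply: (hI d).
    by move: dt; rewrite !inE => /orP[]->; rewrite ?orbT.
  by rewrite mulrCA eQ !big_cons mulrCA.
Qed.

(** All the values that divisibility allows are attained in large degree.  For
    [d] in [t], the constant field along the line [d], multiplied by the forms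
    of all the other lines, yields the fixed form times the product of the
    forms of [t] other than [d]; these products generate all large degrees by
    [lagrange_ideal]. *)
Lemma obstruction_surj a s t u F j :
  a != 0 -> distinct_lines s -> {in s, forall c, ~~ (c <= a)%MS} ->
  perm_eq s (t ++ u) -> uniq [seq pencil a d | d <- t] ->
  {in u, forall c, pencil a c \in [seq pencil a d | d <- t]} ->
  (size t <= j.+1)%N -> F \is j.-homog ->
  exists th, [/\ der s th, vhomog (j + size u) th &
    obstruction a th = (\prod_(c <- u) lf (trace_on a c)) * restr a F].
Proof.
move=> a0 hs sa p ut hu szj hF; have [us s0 ds] := hs.
set B := \prod_(c <- u) _.
have hB : B \is (size u).-homog.
  have -> : B = \prod_(c <- [seq trace_on a d | d <- u]) lf c by rewrite big_map.
  by rewrite -(size_map (trace_on a)); apply: prod_lf_homog.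
pose I F := exists2 th, der s th & obstruction a th = B * restr a F.
suff [th dth eth] : I F.
  exists (vpi (j + size u) th); split; [exact: der_vpi | exact: vpi_homog | ].
  rewrite /obstruction ev_vpi restr_pihomog [restr _ _]eth addnC.
  by rewrite (pihomogM _ _ hB) pihomog_dE // restr_homog.
have I0 : I 0 by exists 0 => [b _|]; rewrite ?/obstruction ev0; [apply: dvdr0 | rewrite !linear0 mulr0].
have ID F1 F2 : I F1 -> I F2 -> I (F1 + F2).
  move=> [th1 d1 e1] [th2 d2 e2]; exists (th1 + th2); first exact: derD.
  by rewrite obstructionD e1 e2 linearD mulrDr.
have IM F1 F2 : I F2 -> I (F1 * F2).
  move=> [th2 d2 e2]; exists (F1 *: th2); first exact: derZ.
  by rewrite obstructionZ e2 rmorphM mulrCA.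
have Ia : I (lf a).
  by case: I0 => th dth eth; exists th => //; rewrite eth linear0 restr_lf.
have IX m : mdeg m = j -> I 'X_[m].
  have [t0|tn0] := eqVneq t [::].
    have u0 : u = [::] by case: (u) hu => [//|c u' /(_ c (mem_head _ _))]; rewrite t0.
    have se : s = [::] by apply: perm_nilP; rewrite (perm_trans p) // t0 u0.
    move=> _; rewrite -['X_[m]]mulr1; apply: IM.
    exists (\row_i (transversal a i)%:MP); first by rewrite se.
    rewrite /B u0 big_nil mul1r rmorph1 /obstruction /ev.
    under eq_bigr => i _ do rewrite mxE -mul_mpolyC -mpolyCM.
    by rewrite -raddf_sum /= transversalP // rmorph1.
  move=> hm; apply: (lagrange_ideal a0 tn0) => //; last by rewrite hm.
    by move=> c ct; apply: sa; rewrite (perm_mem p) mem_cat ct.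
  move=> d dt Q eQ.
  have ds' : d \in s by rewrite (perm_mem p) mem_cat dt.
  have [v [_ ev_d ev_a]] : exists v : V, [/\ vhomog 0 v, ev d v = 0 & ev a v = 1].
    apply: transversal_along; first exact: s0.
    by apply: contraNN (sa d ds') => /submx_rV_sym; apply.
  exists ((Q * \prod_(c <- u) lf c) *: v); last first.
    rewrite obstructionZ /obstruction ev_a rmorph1 mulr1 rmorphM mulrC; congr (_ * _).
    by rewrite rmorph_prod; apply: eq_bigr => c _; rewrite /= restr_lf_trace.
  move=> c cs; rewrite evZ.
  have [->|cd] := eqVneq c d; first by rewrite ev_d mulr0; apply: dvdr0.
  apply: dvdr_mulr.
  have : dvdr (lf c) (lf d * (Q * \prod_(c <- u) lf c)).
    rewrite mulrA eQ -big_cat -(perm_big _ p) /= (big_rem c) //=.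
    by apply/dvdr_mulr/dvdrr.
  case/(lf_prime (s0 c cs)) => // /(restr_eq0 _ (s0 c cs))/eqP.
  by rewrite restr_lf_eq0 ?s0 // => /(ds _ _ cs ds') e; rewrite e eqxx in cd.
rewrite [F]mpolyE; move: hF => /dhomogP.
elim: (msupp F) => [|m r ihr] hr; first by rewrite big_nil.
rewrite big_cons; apply: ID.
  by rewrite -mul_mpolyC; apply/IM/IX/hr; rewrite mem_head.
by apply: ihr => m' m'r; apply: hr; rewrite inE m'r orbT.
Qed.

End Interpolation.

(** * Hilbert functions *)

Section HilbertFunction.
Variable K : fieldType.
Notation S := {mpoly K[3]}.
Notation V := 'rV[S]_3.
Notation Sd := (dhomog 3 K).
Implicit Types (a b c : 'rV[K]_3) (F G P : S) (s t u v : seq 'rV[K]_3) (th : V) (d e j k : nat).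

(** The homogeneous component of degree [d], as an element of a
    finite-dimensional space. *)
Definition ph d F : Sd d := DHomog (pihomogP mdeg d F).

Lemma ph_is_linear d : linear (ph d).
Proof. by move=> x F G; apply: val_inj; rewrite /= linearP. Qed.
HB.instance Definition _ d := GRing.isLinear.Build K S (Sd d) _ (ph d) (@ph_is_linear d).

Lemma valP_homog d (F : Sd d) : val F \is d.-homog.
Proof. exact: dhomog_is_dhomog. Qed.
#[local] Hint Resolve valP_homog : core.

Lemma val_ph d F : F \is d.-homog -> val (ph d F) = F.
Proof. by move=> hF; rewrite /= pihomog_dE. Qed.

Lemma ph_val d (F : Sd d) : ph d (val F) = F.
Proof. by apply: val_inj; rewrite val_ph ?dhomog_is_dhomog. Qed.

Lemma ph_eq0 d F : F \is d.-homog -> (ph d F == 0) = (F == 0).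
Proof. by move=> hF; rewrite -val_eqE /= pihomog_dE. Qed.

Lemma dim_forms d : \dim {:Sd d} = 'C(d + 2, 2).
Proof. by rewrite dimvf [dim _]/= -[RHS]bin_sub ?leq_addl // addnK. Qed.

Definition mulf k d G (F : Sd d) : Sd k := ph k (G * val F).

Lemma mulf_is_linear k d G : linear (@mulf k d G).
Proof. by move=> x F F'; rewrite /mulf linearP /= mulrDr -scalerAr linearP. Qed.
HB.instance Definition _ k d G :=
  GRing.isLinear.Build K (Sd d) (Sd k) _ (@mulf k d G) (@mulf_is_linear k d G).

Definition restrf d a (F : Sd d) : Sd d := ph d (restr a (val F)).

Lemma restrf_is_linear d a : linear (@restrf d a).
Proof. by move=> x F F'; rewrite /restrf !linearP. Qed.
HB.instance Definition _ d a :=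
  GRing.isLinear.Build K (Sd d) (Sd d) _ (@restrf d a) (@restrf_is_linear d a).

Lemma dim_mulf k d e G (U : {vspace Sd d}) : k = (e + d)%N -> G != 0 ->
  G \is e.-homog -> \dim (linfun (@mulf k d G) @: U) = \dim U.
Proof.
move=> -> G0 hG; apply: limg_dim_eq; apply/eqP; rewrite -subv0; apply/subvP => F.
rewrite memv_cap memv_ker lfunE /= memv0 => /andP[_].
rewrite /mulf ph_eq0; last exact: dhomogM.
by rewrite mulf_eq0 (negbTE G0) /= -val_eqE.
Qed.

(** The kernel consists of the multiples of [lf a], so the dimension is
    ['C(d + 2, 2) - 'C(d + 1, 2)]. *)
Lemma dim_restrf d a : a != 0 -> \dim (linfun (@restrf d a) @: fullv) = d.+1.
Proof.
move=> a0; have := limg_ker_dim (linfun (@restrf d a)) fullv.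
rewrite capfv dim_forms.
have kerE (F : Sd d) : (F \in lker (linfun (@restrf d a))) = (restr a (val F) == 0).
  by rewrite memv_ker lfunE /= /restrf ph_eq0 // restr_homog.
case: d kerE => [|d] kerE.
  suff /eqP -> : (lker (linfun (@restrf 0 a)) == 0)%VS by rewrite dimv0.
  rewrite -subv0; apply/subvP => F; rewrite kerE memv0 => /eqP /(restr_eq0 _ a0).
  case=> G eF; have := pihomogM_lt G (lf_homog a) (ltn0Sn 0); rewrite -eF pihomog_dE // => F0.
  by rewrite -val_eqE /= F0.
suff -> : lker (linfun (@restrf d.+1 a)) = (linfun (@mulf d.+1 d (lf a)) @: fullv)%VS.
  rewrite (@dim_mulf _ _ 1) ?lf_eq0 ?lf_homog // dim_forms.
  by rewrite addSn binS bin1 => /eqP; rewrite eqn_add2l addn2 => /eqP.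
apply/vspaceP => F; rewrite kerE; apply/eqP/memv_imgP => [|[G _ ->]]; last first.
  rewrite lfunE /mulf /= pihomog_dE; first by rewrite rmorphM /= restr_lf // mul0r.
  exact: (dhomogM (lf_homog a) (valP_homog G)).
move/(restr_eq0 _ a0) => [G eF]; exists (ph d G); rewrite ?memvf // lfunE /=.
apply: val_inj; rewrite /mulf val_ph /=; last exact: (dhomogM (lf_homog a) (pihomogP _ _ _)).
by rewrite -(pihomogM d G (lf_homog a)) -eF pihomog_dE.
Qed.

(** ** Homogeneous derivations *)

Notation W k := {ffun 'I_3 -> Sd k}.

Definition toV k (w : W k) : V := \row_i val (w i).
Definition ofV k th : W k := [ffun i => ph k (th 0 i)].

Lemma toV_homog k (w : W k) : vhomog k (toV w).
Proof. by move=> i; rewrite mxE. Qed.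

Lemma ofVK k th : vhomog k th -> toV (ofV k th) = th.
Proof. by move=> h; apply/rowP => i; rewrite mxE ffunE val_ph. Qed.

Lemma toVK k (w : W k) : ofV k (toV w) = w.
Proof. by apply/ffunP => i; rewrite ffunE mxE ph_val. Qed.

Definition obsf k a (w : W k) : Sd k := ph k (obstruction a (toV w)).

Lemma obsf_is_linear k a : linear (@obsf k a).
Proof.
move=> x w w'; rewrite /obsf /obstruction -!linearP; congr (ph k _); congr (restr a _).
rewrite /ev scaler_sumr -big_split /=; apply: eq_bigr => i _.
by rewrite !mxE !ffunE /= scalerDr !scalerA mulrC.
Qed.
HB.instance Definition _ k a :=
  GRing.isLinear.Build K (W k) (Sd k) _ (@obsf k a) (@obsf_is_linear k a).

Definition der_part s k : {vspace W k} := (\bigcap_(b <- s) lker (linfun (@obsf k b)))%VS.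

Lemma obsf_eq0 k a (w : W k) : (obsf a w == 0) = (obstruction a (toV w) == 0).
Proof. by rewrite /obsf ph_eq0 // restr_homog // ev_homog //; apply: toV_homog. Qed.

Lemma mem_der_part s k (w : W k) : {in s, forall b, b != 0} ->
  (w \in der_part s k) <-> der s (toV w).
Proof.
rewrite /der_part; elim: s => [|b s ih] s0; first by rewrite big_nil memvf; split.
rewrite big_cons memv_cap memv_ker lfunE /= obsf_eq0 der_cons ?s0 ?mem_head //.
have -> : der s (toV w) <-> (w \in (\bigcap_(j <- s) lker (linfun (obsf j)))%VS).
  by split=> /ih; apply=> c cs; apply: s0; rewrite inE cs orbT.
by split=> [/andP[/eqP]|[-> ->]]; rewrite ?eqxx.
Qed.

(** The obstructions of the derivations of degree [k] are the restrictions to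
    the line of the forms of degree [k - |u|], times a fixed form: a space of
    dimension [k - |u| + 1], where [|u|] is [|s|] minus the number of points. *)
Lemma hilbert_cons a s k :
  a != 0 -> distinct_lines s -> {in s, forall c, ~~ (c <= a)%MS} -> (size s <= k.+1)%N ->
  (\dim (der_part (a :: s) k) + k.+1 + npoints a s = \dim (der_part s k) + size s)%N.
Proof.
move=> a0 hs sa szk; have [us s0 ds] := hs.
have [t [u [p ut hu st]]] := representatives (pencil a) s.
have szs : size s = (size t + size u)%N by rewrite (perm_size p) size_cat.
have szu : (size u <= k)%N.
  case: t ut hu p st szs => [|c t] ut hu p st szs; first by case: (u) hu => // c u' /(_ c (mem_head _ _)).
  by rewrite -ltnS (leq_trans _ szk) // szs addSn ltnS leq_addl.
pose j := (k - size u)%N; have ek : k = (size u + j)%N by rewrite subnKC.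
rewrite /npoints -st /der_part big_cons capvC -/(der_part s k).
rewrite -(limg_ker_dim (linfun (@obsf k a)) (der_part s k)).
suff -> : \dim (linfun (@obsf k a) @: der_part s k) = j.+1.
  by rewrite szs -!addnA; congr (_ + _)%N; rewrite ek !addSn addnAC addnC (addnC (size u)).
clear st; set B := \prod_(c <- [seq trace_on a c | c <- u]) lf c.
have hB : B \is (size u).-homog by rewrite -(size_map (trace_on a)) prod_lf_homog.
have B0 : B != 0.
  apply: prod_lf_neq0 => _ /mapP[c cu ->]; rewrite trace_on_eq0 // sa //.
  by rewrite (perm_mem p) mem_cat cu orbT.
have -> : (linfun (@obsf k a) @: der_part s k =
    linfun (@mulf k j B) @: (linfun (@restrf j a) @: fullv))%VS; last first.
  by rewrite (dim_mulf _ ek B0 hB) dim_restrf.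
have mulK G : G \is j.-homog -> val (@mulf k j B (ph j G)) = B * G.
  by move=> hG; rewrite /mulf val_ph val_ph // [X in _ \is X.-homog]ek dhomogM.
apply/vspaceP => F; apply/memv_imgP/memv_imgP => [[w ws ->]|[_ /memv_imgP[G _ ->] ->]].
  have [G eG] := dvdr_obstruction a0 hs sa p hu ((mem_der_part _ s0).1 ws).
  have hG : ph j (restr a G) = linfun (@restrf j a) (ph j G).
    by rewrite lfunE /restrf; apply: val_inj => /=; rewrite restr_pihomog pihomog_id.
  exists (ph j (restr a G)); first by rewrite hG memv_img ?memvf.
  rewrite !lfunE; apply: val_inj; rewrite /= /mulf /=.
  rewrite -(pihomogM _ _ hB) -ek pihomog_id.
  have -> : B = restr a B.
    rewrite /B rmorph_prod /=; rewrite !big_map; apply: eq_bigr => c _.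
    by rewrite -restr_lf_trace restrK.
  rewrite -rmorphM /B big_map -eG [obstruction _ _]/=; congr pihomog.
  exact: (esym (restrK _ a0)).
have hjs : (size t <= j.+1)%N by rewrite -(leq_add2r (size u)) -szs addSn addnC -ek.
have [th [dth hth eth]] := obstruction_surj a0 hs sa p ut hu hjs (dhomog_is_dhomog G).
rewrite addnC -ek in hth.
exists (ofV k th); first by apply/mem_der_part; rewrite ?ofVK.
rewrite !lfunE; apply: val_inj; transitivity (B * restr a (val G)).
  by rewrite mulK // restr_homog.
rewrite /B big_map -eth /= ofVK //; apply/esym/pihomog_dE.
by apply/restr_homog/ev_homog.
Qed.

End HilbertFunction.

(** * Bases *)

Section Bases.
Variable K : fieldType.
Notation S := {mpoly K[3]}.
Notation V := 'rV[S]_3.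
Implicit Types (x : K) (a b c y z : 'rV[K]_3) (F G P g h : S) (s t u : seq 'rV[K]_3) (th eta : V)
  (M N : V -> Prop) (d e k : nat).

Definition basis3 M (x y z : V) : Prop :=
  (forall v, M v <-> exists c0 c1 c2 : S, v = c0 *: x + c1 *: y + c2 *: z) /\
  (forall c0 c1 c2 : S, c0 *: x + c1 *: y + c2 *: z = 0 -> [/\ c0 = 0, c1 = 0 & c2 = 0]).

Lemma basis3_eq M N (x y z : V) : (forall v, M v <-> N v) -> basis3 M x y z -> basis3 N x y z.
Proof. by move=> MN [gen free]; split=> // v; rewrite -MN; apply: gen. Qed.

Lemma basis3_swap M (x y z : V) : basis3 M x y z -> basis3 M x z y.
Proof.
case=> gen free; split=> [v|c0 c1 c2]; last first.
  by rewrite addrAC => /free[].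
by rewrite gen; split=> -[c0 [c1 [c2 ->]]]; exists c0, c2, c1; rewrite addrAC.
Qed.

Lemma basis3_mem M (x y z : V) : basis3 M x y z -> [/\ M x, M y & M z].
Proof.
case=> gen _; split; apply/gen.
- by exists 1, 0, 0; rewrite scale1r !scale0r !addr0.
- by exists 0, 1, 0; rewrite scale1r !scale0r addr0 add0r.
by exists 0, 0, 1; rewrite scale1r !scale0r !add0r.
Qed.

(** Maps like [obstruction a], semilinear over the restriction to [a]. *)
Definition restr_linear a (f : V -> S) : Prop :=
  (forall th eta, f (th + eta) = f th + f eta) /\
  (forall F th, f (F *: th) = restr a F * f th).

Lemma restr_linearN a f th : restr_linear a f -> f (- th) = - f th.
Proof. by case=> fD fZ; rewrite -scaleN1r fZ rmorphN rmorph1 mulN1r. Qed.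

(** Modulo [a] the relations between [f th1] and [f th2] are generated by
    [f th2 = g * f th1]; so a combination with coefficients [c1] and [c2] of [th1]
    and [th2] is in the kernel exactly when [lf a] divides [c1 + c2 * g]. *)
Lemma kernel_basis M a f (x th1 th2 : V) g :
  a != 0 -> restr_linear a f -> basis3 M x th1 th2 -> f x = 0 -> f th1 != 0 ->
  f th2 = restr a g * f th1 ->
  basis3 (fun v => M v /\ f v = 0) x (lf a *: th1) (th2 - g *: th1).
Proof.
move=> a0 fl [gen free] fx f1 f2; have [fD fZ] := fl.
split=> [v|c0 c1 c2 e]; last first.
  have /free[c00 e1 c20] : c0 *: x + (c1 * lf a - c2 * g) *: th1 + c2 *: th2 = 0.
    by rewrite -[RHS]e scalerBr !scalerA scalerBl -!addrA; congr (_ + (_ + _)); rewrite addrC.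
  move: e1; rewrite c20 mul0r subr0 => /eqP.
  by rewrite mulf_eq0 lf_eq0 (negbTE a0) orbF => /eqP.
split=> [[/gen[c0 [c1 [c2 ->]]]]|[c0 [c1 [c2 ->]]]].
  rewrite !fD !fZ fx mulr0 add0r f2 mulrA -mulrDl -rmorphM -rmorphD /=.
  move/eqP; rewrite mulf_eq0 (negbTE f1) orbF => /eqP /(restr_eq0 _ a0)[q eq].
  exists c0, q, c2; rewrite scalerA scalerBr scalerA [q * _]mulrC -eq scalerDl.
  by rewrite -!addrA; congr (_ + (_ + _)); rewrite addrCA subrr addr0.
split; last first.
  rewrite !(fD, fZ, restr_linearN _ fl) fx mulr0 add0r restr_lf // mul0r mulr0 add0r f2.
  by rewrite subrr mulr0.
apply/gen; exists c0, (c1 * lf a - c2 * g), c2.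
by rewrite scalerBr !scalerA scalerBl -!addrA; congr (_ + (_ + _)); rewrite addrC.
Qed.

Lemma obstruction_restr_linear a : restr_linear a (obstruction a).
Proof. by split; [apply: obstructionD | apply: obstructionZ]. Qed.

Lemma msize_homog d F : F \is d.-homog -> F != 0 -> msize F = d.+1.
Proof.
move=> hF F0; have := dhomog_uniq F0 hF (dhomog_msize hF) => ->.
by rewrite mpolySpred // msize_poly_eq0.
Qed.

(** A divisor of a nonzero form which has the same degree, or a greater one,
    is proportional to it, so that all its multiples are multiples of the form. *)
Lemma dvdr_homog_assoc d e P F G :
  P \is d.-homog -> F \is e.-homog -> (e <= d)%N -> F != 0 ->
  dvdr P F -> dvdr P G -> exists g, G = g * F.
Proof.
move=> hP hF ed F0 [H eF] [G' ->].
have [P0 H0] : P != 0 /\ H != 0.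
  by split; apply: contraNneq F0 => z0; rewrite eF z0 ?mul0r ?mulr0.
have := msize_homog hF F0; rewrite {1}eF msizeM // (msize_homog hP P0) addSn /= => sH.
have sH1 : msize H = 1%N.
  have : (d + msize H <= d + 1)%N by rewrite sH addn1 ltnS.
  rewrite leq_add2l => h; apply/eqP; rewrite eqn_leq h lt0n msize_poly_eq0 //.
have /msize_poly1P[c c0 eH] : msize H == 1%N by rewrite sH1.
exists (c^-1%:MP * G'); rewrite eF eH.
have -> : c^-1%:MP * G' * (P * c%:MP) = (c^-1%:MP * c%:MP) * (P * G') by ring.
by rewrite -mpolyCM mulVf // mpolyC1 mul1r.
Qed.

Lemma lf_comb3 (x1 x2 x3 : K) a b c :
  lf (x1 *: a + x2 *: b + x3 *: c) = x1 *: lf a + x2 *: lf b + x3 *: lf c.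
Proof. by rewrite -[x1 *: a + x2 *: b]scale1r lfE scale1r lfE. Qed.

Lemma ev_comb3 (x1 x2 x3 : K) a b c th :
  ev (x1 *: a + x2 *: b + x3 *: c) th = x1 *: ev a th + x2 *: ev b th + x3 *: ev c th.
Proof. by rewrite -[x1 *: a + x2 *: b]scale1r ev_lin scale1r ev_lin. Qed.

Lemma dvdr_scale x P F : x != 0 -> dvdr P (x *: F) -> dvdr P F.
Proof.
move=> x0 [G eG]; exists (x^-1 *: G); apply: (scalerI x0).
by rewrite eG scalerAr scalerA divff // scale1r.
Qed.

(** ** The bivector with the Euler field *)

Section Deletion.
Variables (a y z : 'rV[K]_3).
Hypotheses (a0 : a != 0) (ya : ~~ (y <= a)%MS) (zay : ~~ (z <= a + y)%MS).

(** The derivations tangent to the line [a] restrict to it; this is the bivector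
    that they form there with the Euler field. *)
Definition wedge_euler th : S := restr a (lf z * ev y th - lf y * ev z th).

Lemma wedge_restr_linear : restr_linear a wedge_euler.
Proof.
rewrite /wedge_euler; split=> [th eta|F th].
  by rewrite !evD -rmorphD /=; congr (restr a _); rewrite !mulrDr opprD addrACA.
by rewrite !evZ -rmorphM /= mulrBr mulrCA [lf y * _]mulrCA.
Qed.

Lemma wedge_eulerE : wedge_euler (euler K 3) = 0.
Proof. by rewrite /wedge_euler !ev_euler mulrC subrr linear0. Qed.

Lemma wedge_homog d th : vhomog d th -> wedge_euler th \is d.+1.-homog.
Proof.
move=> hth; apply/restr_homog/rpredB; exact: (dhomogM (lf_homog _) (ev_homog _ hth)).
Qed.

Lemma za : ~~ (z <= a)%MS.
Proof. by apply: contraNN zay => h; apply: submx_trans h (addsmxSl _ _). Qed.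

(** At the point where [b] meets [a], [th] is tangent to both lines, hence
    proportional to the Euler field.  Algebraically, if [b] is
    [be * y + ga * z] modulo [a], then the products of the bivector with [be] and
    with [ga] are combinations of [lf b] and of the value of [th] on it. *)
Lemma dvdr_wedge b th : ~~ (b <= a)%MS -> obstruction a th = 0 -> dvdr (lf b) (ev b th) ->
  dvdr (lf (trace_on a b)) (wedge_euler th).
Proof.
move=> ba; rewrite /obstruction => oth [q eq].
have [x0 [be [ga eb]]] := mem_span3 b a0 ya zay.
set Y := restr a (ev y th); set Z := restr a (ev z th).
set y' := restr a (lf y); set z' := restr a (lf z).
have wE : wedge_euler th = z' * Y - y' * Z by rewrite /wedge_euler linearB /= !rmorphM.
have el : restr a (lf b) = be%:MP * y' + ga%:MP * z'.
  by rewrite eb lf_comb3 !linearD !linearZ /= restr_lf // scaler0 add0r !mul_mpolyC.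
have ev' : be%:MP * Y + ga%:MP * Z = restr a (lf b) * restr a q.
  rewrite -rmorphM /= -eq eb ev_comb3 !linearD !linearZ /= oth scaler0 add0r.
  by rewrite !mul_mpolyC.
rewrite -restr_lf_trace wE.
have [be0|be0] := eqVneq be 0; last first.
  apply: (dvdr_scale be0).
  have -> : be *: (z' * Y - y' * Z) = z' * (restr a (lf b) * restr a q) - Z * restr a (lf b).
    by rewrite -ev' el -mul_mpolyC; ring.
  by apply: dvdrB; [apply/dvdr_mull/dvdr_mulr/dvdrr | apply/dvdr_mull/dvdrr].
have ga0 : ga != 0.
  apply: contraNneq ba => ga0; rewrite eb be0 ga0 !scale0r !addr0.
  by rewrite scalemx_sub.
apply: (dvdr_scale ga0).
have -> : ga *: (z' * Y - y' * Z) = Y * restr a (lf b) - y' * (restr a (lf b) * restr a q).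
  by rewrite -ev' el -mul_mpolyC; ring.
by apply: dvdrB; [apply/dvdr_mull/dvdrr | apply/dvdr_mull/dvdr_mulr/dvdrr].
Qed.

(** On [a], the vanishing of the bivector says that [(th(y), th(z))] is
    proportional to [(y, z)]; as [y] and [z] are coprime there, the factor is a
    polynomial [h], and [th - h * euler] vanishes on [a]. *)
Lemma wedge_kernel th : obstruction a th = 0 -> wedge_euler th = 0 ->
  exists h eta, th = h *: euler K 3 + lf a *: eta.
Proof.
rewrite /obstruction => oth; rewrite /wedge_euler linearB /= !rmorphM /= => /eqP.
set Y := restr a (ev y th); set Z := restr a (ev z th).
rewrite !restr_lf_trace subr_eq0 => /eqP eYZ.
have y'0 : trace_on a y != 0 by rewrite trace_on_eq0.
have [h eh] : dvdr (lf (trace_on a y)) Y.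
  have [] // : dvdr (lf (trace_on a y)) (lf (trace_on a z)) \/ dvdr (lf (trace_on a y)) Y.
    by apply: lf_prime => //; rewrite eYZ; apply/dvdr_mulr/dvdrr.
  move/(restr_eq0 _ y'0)/eqP; rewrite restr_lf_eq0 // trace_on_sub ?za //.
  by rewrite (negbTE zay).
have eZ : Z = lf (trace_on a z) * h.
  have y'0' : lf (trace_on a y) != 0 by rewrite lf_eq0.
  by apply: (mulfI y'0'); rewrite -eYZ eh mulrCA.
pose w := th - restr a h *: euler K 3.
have wd b : dvdr (lf a) (ev b w).
  apply/(restr_eq0 _ a0).
  have ha : restr a (ev a w) = 0.
    by rewrite evB evZ ev_euler linearB rmorphM /= oth restr_lf // mulr0 subr0.
  have hy : restr a (ev y w) = 0.
    rewrite evB evZ ev_euler linearB rmorphM /= restrK // restr_lf_trace.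
    by rewrite -{1}[restr a (ev y th)]restrK // -/Y eh rmorphM /= -restr_lf_trace restrK // mulrC subrr.
  have hz : restr a (ev z w) = 0.
    rewrite evB evZ ev_euler linearB rmorphM /= restrK // restr_lf_trace.
    by rewrite -{1}[restr a (ev z th)]restrK // -/Z eZ rmorphM /= -restr_lf_trace restrK // mulrC subrr.
  have [x1 [x2 [x3 ->]]] := mem_span3 b a0 ya zay.
  by rewrite ev_comb3 !linearD !linearZ /= ha hy hz !scaler0 !addr0.
have /fin_all_exists[eta heta] i : exists g, w 0 i = lf a * g by rewrite -ev_delta; apply: wd.
exists (restr a h), (\row_i eta i).
apply/eqP; rewrite addrC -subr_eq -/w; apply/eqP/rowP => i.
by rewrite heta !mxE.
Qed.

End Deletion.
End Bases.

(** * Hilbert functions of free modules *)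

Section Free.
Variable K : fieldType.
Notation S := {mpoly K[3]}.
Notation V := 'rV[S]_3.
Notation Sd := (dhomog 3 K).
Notation W k := {ffun 'I_3 -> dhomog 3 K k}.
Implicit Types (a b : 'rV[K]_3) (s t u : seq 'rV[K]_3) (th : V) (d e k : nat)
  (M : V -> Prop).

Definition is_basis M m (e : 'I_m -> V) : Prop :=
  (forall v, M v <-> exists c : 'I_m -> S, v = \sum_(i < m) c i *: e i) /\
  (forall c : 'I_m -> S, \sum_(i < m) c i *: e i = 0 -> forall i, c i = 0).

Lemma is_basis_eq M N m (e : 'I_m -> V) :
  (forall v, M v <-> N v) -> is_basis M e -> is_basis N e.
Proof. by move=> MN [gen free]; split=> // v; rewrite -MN; apply: gen. Qed.

Lemma is_basis_mem M m (e : 'I_m -> V) i : is_basis M e -> M (e i).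
Proof.
case=> gen _; apply/gen; exists (fun j : 'I_m => (j == i)%:R).
rewrite (bigD1 i) //= eqxx scale1r big1 ?addr0 // => j /negbTE ji.
by case: eqP ji => // _ _; rewrite scale0r.
Qed.

Lemma basis3_is_basis M (x y z : V) :
  basis3 M x y z <-> is_basis M (fun i : 'I_3 => [:: x; y; z]`_i).
Proof.
have sumE (c : 'I_3 -> S) : \sum_(i < 3) c i *: [:: x; y; z]`_i =
    c ord0 *: x + c (lift ord0 ord0) *: y + c ord_max *: z.
  by rewrite !big_ord_recl big_ord0 addr0 !addrA; congr (_ + c _ *: _); apply: val_inj.
pose C (c0 c1 c2 : S) (i : 'I_3) := [:: c0; c1; c2]`_i.
split=> -[gen free]; split=> [v|c].
- rewrite gen; split=> [[c0 [c1 [c2 ->]]]|[c ->]]; last by rewrite sumE; do 3!eexists.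
  by exists (C c0 c1 c2); rewrite sumE.
- rewrite sumE => /free[h0 h1 h2] i; case: i => -[|[|[|//]]] lt.
  + by rewrite -h0; congr c; apply: val_inj.
  + by rewrite -h1; congr c; apply: val_inj.
  by rewrite -h2; congr c; apply: val_inj.
- rewrite gen; split=> [[c ->]|[c0 [c1 [c2 ->]]]]; first by rewrite sumE; do 3!eexists.
  by exists (C c0 c1 c2); rewrite sumE.
move=> c1 c2 e0; have := free (C c c1 c2); rewrite sumE => /(_ e0) h.
by split; [apply: (h ord0) | apply: (h (lift ord0 ord0)) | apply: (h ord_max)].
Qed.

Definition vmulf k d th (F : Sd d) : W k := ofV k (val F *: th).

Lemma vmulf_is_linear k d th : linear (@vmulf k d th).
Proof.
move=> x F F'; apply/ffunP => i; rewrite !ffunE !mxE /= mulrDl -scalerAl linearP.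
by [].
Qed.
HB.instance Definition _ k d th :=
  GRing.isLinear.Build K (Sd d) (W k) _ (@vmulf k d th) (@vmulf_is_linear k d th).

Lemma toV_inj k : injective (@toV K k).
Proof. by move=> w w' h; rewrite -[w]toVK h toVK. Qed.

Lemma toV_sum k (I : Type) (r : seq I) (P : pred I) (f : I -> W k) :
  toV (\sum_(i <- r | P i) f i) = \sum_(i <- r | P i) toV (f i).
Proof.
apply: big_morph => [w w'|]; apply/rowP => i; rewrite !mxE ffunE //.
Qed.

Lemma toV_vmulf k d e th (F : Sd d) : k = (e + d)%N -> vhomog e th ->
  toV (vmulf k th F) = val F *: th.
Proof.
move=> ek hth; rewrite ofVK // => i; rewrite ek addnC.
exact: (vhomogZ (valP_homog F) hth).
Qed.

(** In degree [k] the module is the direct sum of the multiples of the [e i] by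
    the forms of degree [k - de i]. *)
Lemma hilbert_basis s m (e : 'I_m -> V) (de : 'I_m -> nat) k :
  {in s, forall b, b != 0} -> is_basis (der s) e ->
  (forall i, vhomog (de i) (e i)) -> (forall i, de i <= k)%N ->
  \dim (der_part s k) = (\sum_(i < m) 'C(k - de i + 2, 2))%N.
Proof.
move=> s0 be he le_k; have [gen free] := be.
have ek i : k = (de i + (k - de i))%N by rewrite subnKC.
pose U i := (linfun (@vmulf k (k - de i) (e i)) @: fullv)%VS.
have tV i (F : Sd (k - de i)) := toV_vmulf F (ek i) (he i).
have e_neq0 i : e i != 0.
  apply/eqP => ei0; have := free (fun j : 'I_m => (j == i)%:R).
  rewrite (bigD1 i) //= eqxx ei0 scaler0 add0r big1 => [/(_ erefl i)/eqP|j /negbTE ji].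
    by rewrite eqxx oner_eq0.
  by case: eqP ji => // _ _; rewrite scale0r.
have -> : der_part s k = (\sum_i U i)%VS.
  apply/vspaceP => w; apply/idP/memv_sumP => [/(mem_der_part _ s0)/gen[c ew]|[f fU ->]].
    exists (fun i => vmulf k (e i) (ph (k - de i) (c i))) => [i _|].
      by apply/memv_imgP; exists (ph (k - de i) (c i)); rewrite ?memvf ?lfunE.
    apply: toV_inj; rewrite toV_sum -(vpi_id (toV_homog w)) ew vpi_sum.
    by apply: eq_bigr => i _; rewrite tV {1}(ek i) vpiZ.
  apply/mem_der_part => //; rewrite toV_sum; elim/big_ind: _ => [b _||i _].
  - by rewrite ev0; apply: dvdr0.
  - by move=> x y; apply: derD.
  have /memv_imgP[F _ ->] := fU i isT; rewrite lfunE /= tV.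
  exact/derZ/(is_basis_mem i be).
have /directvP -> /= : directv (\sum_i U i).
  apply/directv_sum_independent => f fU f0 i _.
  have /fin_all_exists[F eF] j : exists F, f j = @vmulf k (k - de j) (e j) F.
    by have /memv_imgP[F _ ->] := fU j isT; exists F; rewrite lfunE.
  have h : \sum_j val (F j) *: e j = 0.
    transitivity (toV (\sum_j f j)).
      by rewrite toV_sum; apply: eq_bigr => j _; rewrite eF tV.
    by rewrite f0; apply/rowP => j; rewrite !mxE ffunE.
  have F0 : F i = 0 by apply: val_inj; rewrite (free _ h).
  by rewrite eF F0 linear0.
apply: eq_bigr => i _; rewrite limg_dim_eq ?dim_forms //.
apply/eqP; rewrite -subv0; apply/subvP => F.
rewrite memv_cap memv_ker lfunE /= memv0 memvf /= => /eqP/(congr1 (@toV K k)).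
rewrite tV => eF; rewrite -val_eqE /=; apply: contraR (e_neq0 i) => F0.
apply/eqP/rowP => j; have /rowP/(_ j) := eF; rewrite !mxE ffunE /= => /eqP.
by rewrite mulf_eq0 (negbTE F0) => /eqP.
Qed.
End Free.

Lemma bin2D1 n : 'C(n.+1, 2) = ('C(n, 2) + n)%N.
Proof. by rewrite binS bin1. Qed.

Lemma bin2_2 n : ('C(n, 2) * 2 + n = n * n)%N.
Proof. elim: n => [|n]; rewrite ?bin2D1 //; lia. Qed.

(** Second differences count the summands. *)
Lemma hilbert_rank m (de : 'I_m -> nat) a b K0 :
  (forall k, (K0 <= k)%N ->
     \sum_(i < m) 'C(k - de i + 2, 2) = 'C(k - a + 2, 2) + 'C(k - b + 2, 2))%N ->
  m = 2%N.
Proof.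
move=> h; pose N := (K0 + (a + b) + \sum_i de i)%N.
have leN i : (de i <= N)%N by rewrite /N (bigD1 i) //=; lia.
have step d : (d <= N)%N ->
    ('C(N.+2 - d + 2, 2) + 'C(N - d + 2, 2) = 'C(N.+1 - d + 2, 2) * 2 + 1)%N.
  move=> dN; have -> : (N.+2 - d + 2 = (N - d + 2).+2)%N by lia.
  have -> : (N.+1 - d + 2 = (N - d + 2).+1)%N by lia.
  rewrite !bin2D1; lia.
have [h0 h1 h2] : [/\ K0 <= N, K0 <= N.+1 & K0 <= N.+2]%N by split; lia.
have /eqP := eqxx (\sum_(i < m) ('C(N.+2 - de i + 2, 2) + 'C(N - de i + 2, 2)))%N.
rewrite {1}big_split /= !h //; under eq_bigr => i _ do rewrite step //.
rewrite big_split /= -big_distrl /= h // sum1_card card_ord.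
have := step a; have := step b; lia.
Qed.

(** First differences give the sum of the exponents, and then the values give
    the sum of their squares. *)
Lemma hilbert_exponents c d a b K0 :
  (forall k, (K0 <= k)%N ->
     'C(k - c + 2, 2) + 'C(k - d + 2, 2) = 'C(k - a + 2, 2) + 'C(k - b + 2, 2))%N ->
  (c = a /\ d = b) \/ (c = b /\ d = a).
Proof.
move=> h; pose N := (K0 + (a + b) + (c + d))%N.
have e0 := h N; have e1 := h N.+1.
have step x : (x <= N)%N -> ('C(N.+1 - x + 2, 2) = 'C(N - x + 2, 2) + (N - x + 2))%N.
  by move=> xN; rewrite -bin2D1; congr 'C(_, _); lia.
have [ha hb hc hd] : [/\ a <= N, b <= N, c <= N & d <= N]%N by split; lia.
rewrite !step // in e1.
have {e1}es : (c + d = a + b)%N by have := e0; have := e1; lia.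
have {}e0 := e0 ltac:(lia).
have := bin2_2 (N - a + 2); have := bin2_2 (N - b + 2).
have := bin2_2 (N - c + 2); have := bin2_2 (N - d + 2).
have := es; move: e0 ha hb hc hd; clear.
move: 'C(_, _) 'C(_, _) 'C(_, _) 'C(_, _) => y1 y2 y3 y4 e0 ha hb hc hd es q1 q2 q3 q4.
have : ((N - c + 2) * (N - c + 2) + (N - d + 2) * (N - d + 2) =
        (N - a + 2) * (N - a + 2) + (N - b + 2) * (N - b + 2))%N by lia.
move=> {q1 q2 q3 q4 e0}.
have -> : (N - a + 2 = (N - c + 2) + (N - d + 2) - (N - b + 2))%N by lia.
move=> e.
have : (N - c + 2 = N - b + 2 \/ N - d + 2 = N - b + 2)%N by nia.
lia.
Qed.

(** * Deletion and addition *)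

Section AdditionDeletion.
Variable K : fieldType.
Notation S := {mpoly K[3]}.
Notation V := 'rV[S]_3.
Notation E := (euler K 3).
Implicit Types (a b c y z : 'rV[K]_3) (F G g h : S) (s t u : seq 'rV[K]_3)
  (th eta : V) (M N : V -> Prop) (d e k : nat).

Lemma exists_notin_rowspace m (A : 'M[K]_(m, 3)) :
  (\rank A < 3)%N -> exists c : 'rV[K]_3, ~~ (c <= A)%MS.
Proof.
move=> rA; have [/existsP[i hi]|] := boolP [exists i, ~~ ((delta_mx 0 i : 'rV[K]_3) <= A)%MS].
  by exists (delta_mx 0 i).
rewrite negb_exists => /forallP h; move: rA; rewrite ltnNge => /negP[].
rewrite -{1}(mxrank1 K 3); apply: mxrankS; apply/row_subP => i.
by rewrite row1; move: (h i); rewrite negbK.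
Qed.

Lemma complementary_forms a :
  exists y z, ~~ (y <= a)%MS /\ ~~ (z <= a + y)%MS.
Proof.
have ra b : (\rank b <= 1)%N by rewrite rank_leq_row.
have [|y ya] := @exists_notin_rowspace _ a; first exact: leq_ltn_trans (ra a) _.
have [|z hz] := @exists_notin_rowspace _ (a + y)%MS; last by exists y, z.
apply: leq_ltn_trans (mxrank_adds_leqif a y).1 _.
by apply: leq_ltn_trans (leq_add (ra a) (ra y)) _.
Qed.

Lemma basis3_shift M (x y z : V) F :
  basis3 M x y z -> basis3 M x y (z - F *: x).
Proof.
case=> gen free; split=> [v|c0 c1 c2].
  rewrite gen; split=> -[c0 [c1 [c2 ->]]].
    exists (c0 + c2 * F), c1, c2; rewrite scalerBr scalerA scalerDl -!addrA; congr (_ + _).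
    by rewrite addrCA; congr (_ + _); rewrite addrCA subrr addr0.
  exists (c0 - c2 * F), c1, c2; rewrite scalerBr scalerA scalerBl.
  by rewrite -!addrA; congr (_ + _); rewrite addrCA; congr (_ + _); rewrite addrC.
rewrite scalerBr scalerA => e.
have /free[h0 h1 h2] : (c0 - c2 * F) *: x + c1 *: y + c2 *: z = 0.
  rewrite -[RHS]e scalerBl -!addrA; congr (_ + _); rewrite addrCA; congr (_ + _).
  by rewrite addrC.
by split=> //; move: h0; rewrite h2 mul0r subr0.
Qed.

Lemma scaler_rV_inj F (x y : V) : F != 0 -> F *: x = F *: y -> x = y.
Proof.
move=> F0 /rowP e; apply/rowP => i; apply: (mulfI F0).
by have := e i; rewrite !mxE.
Qed.

Lemma dvdr_lf a b : a != 0 -> dvdr (lf a) (lf b) -> (b <= a)%MS.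
Proof. by move=> a0 /(restr_eq0 _ a0)/eqP; rewrite restr_lf_eq0. Qed.

(** The Euler field does not vanish identically on a line. *)
Lemma euler_coef_dvdr a h th eta : a != 0 ->
  h *: E + lf a *: th = lf a *: eta -> dvdr (lf a) h.
Proof.
move=> a0 e; have [y [_ [ya _]]] := complementary_forms a.
have : dvdr (lf a) (h * lf y).
  exists (ev y (eta - th)); rewrite -evZ scalerBr -e addrK evZ ev_euler //.
by case/(lf_prime a0) => // /(dvdr_lf a0); rewrite (negbTE ya).
Qed.

Lemma divide_basis M N a eta1 eta2 :
  a != 0 -> (forall v, M v <-> N (lf a *: v)) ->
  basis3 N E (lf a *: eta1) (lf a *: eta2) -> basis3 M E eta1 eta2.
Proof.
move=> a0 MN [gen free]; have la0 : lf a != 0 by rewrite lf_eq0.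
split=> [v|c0 c1 c2 e]; last first.
  have /free[h0 h1 h2] : (lf a * c0) *: E + c1 *: (lf a *: eta1) + c2 *: (lf a *: eta2) = 0.
    by rewrite !scalerA [c1 * _]mulrC [c2 * _]mulrC -!scalerA -!scalerDr e scaler0.
  by split=> //; apply: (mulfI la0); rewrite mulr0.
rewrite MN gen; split=> -[c0 [c1 [c2 e]]].
  have [q eq] : dvdr (lf a) c0.
    apply: (@euler_coef_dvdr a c0 (c1 *: eta1 + c2 *: eta2) v a0).
    by rewrite e scalerDr !scalerA [c1 * _]mulrC [c2 * _]mulrC addrA.
  exists q, c1, c2; apply: (scaler_rV_inj la0); rewrite e eq !scalerDr !scalerA.
  by rewrite [c1 * _]mulrC [c2 * _]mulrC.
exists (lf a * c0), c1, c2; rewrite e !scalerDr !scalerA.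
by rewrite [c1 * _]mulrC [c2 * _]mulrC.
Qed.

Lemma vpi_lt_euler h : vpi 0 (h *: E) = 0.
Proof. exact: (vpiZ_lt _ (@euler_homog K 3)). Qed.

(** It suffices to take components of degree [d]; in degree 0 nothing is left. *)
Lemma homog_quotient a d (x : V) h eta : x != 0 -> vhomog d x -> x = h *: E + lf a *: eta ->
  exists d' h' eta', [/\ d = d'.+1, vhomog d' eta' & x = h' *: E + lf a *: eta'].
Proof.
move=> x0 hx ex.
have {ex}: x = vpi d (h *: E) + vpi d (lf a *: eta) by rewrite -vpiD -ex vpi_id.
have laE e : vpi e.+1 (lf a *: eta) = lf a *: vpi e eta.
  by apply/rowP => i; rewrite !mxE (pihomogM e _ (lf_homog a)).
case: d hx => [|d] hx e.
  case/eqP: x0; rewrite e vpi_lt_euler add0r; apply/rowP => i; rewrite !mxE.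
  exact: (pihomogM_lt _ (lf_homog a)).
exists d, (pihomog mdeg d h), (vpi d eta); split=> //; first exact: vpi_homog.
by rewrite e laE; congr (_ + _); apply: (vpiZ d h (@euler_homog K 3)).
Qed.

Lemma der_lf_scale a s eta : a != 0 -> {in s, forall c, ~~ (c <= a)%MS} ->
  {in s, forall c, c != 0} -> der s (lf a *: eta) -> der s eta.
Proof.
move=> a0 sa s0 h b bs; have := h b bs; rewrite evZ.
case/(lf_prime (s0 b bs)) => // /(dvdr_lf (s0 b bs)) /(submx_rV_sym a0).
by rewrite (negbTE (sa b bs)).
Qed.

Lemma hilbert_basis3 s eta1 eta2 e1 e2 k : {in s, forall c, c != 0} ->
  basis3 (der s) E eta1 eta2 -> vhomog e1 eta1 -> vhomog e2 eta2 ->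
  (0 < k)%N -> (e1 <= k)%N -> (e2 <= k)%N ->
  \dim (der_part s k) = ('C(k - 1 + 2, 2) + ('C(k - e1 + 2, 2) + 'C(k - e2 + 2, 2)))%N.
Proof.
move=> s0 /basis3_is_basis hb h1 h2 k0 k1 k2.
rewrite (@hilbert_basis _ s 3 _ (fun i : 'I_3 => nth 0 [:: 1; e1; e2] i)%N k s0 hb).
- by rewrite !big_ord_recl big_ord0 addn0.
- by case=> -[|[|[|//]]] //= _; apply: euler_homog.
by case=> -[|[|[|//]]].
Qed.

Lemma basis3_neq0 M (x y z : V) : basis3 M x y z -> y != 0.
Proof.
case=> _ free; apply/eqP => y0.
have /free[_ /eqP] : (0 : S) *: x + (1 : S) *: y + (0 : S) *: z = 0.
  by rewrite y0 !scale0r scaler0 !addr0.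
by rewrite oner_eq0.
Qed.

(** A case of a theorem of Abe: a line with more than [d1] points can be removed
    from a free arrangement.  The kernel of [wedge_euler] on [der (a :: s)] is
    [S * euler + lf a * der s], so a basis of this kernel gives one of [der s]. *)
Lemma deletion a s th1 th2 d1 d2 :
  a != 0 -> distinct_lines s -> {in s, forall c, ~~ (c <= a)%MS} ->
  basis3 (der (a :: s)) E th1 th2 -> vhomog d1 th1 -> vhomog d2 th2 ->
  (d1 <= d2)%N -> (d1 < npoints a s)%N ->
  exists e1 e2 eta1 eta2, [/\ basis3 (der s) E eta1 eta2, vhomog e1 eta1,
    vhomog e2 eta2 & size s = (npoints a s + e2)%N].
Proof.
move=> a0 hs sa hb h1 h2 d12 ltr; have [us s0 ds] := hs.
have [y [z [ya zay]]] := complementary_forms a.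
set f := wedge_euler a y z.
have fl : restr_linear a f := wedge_restr_linear a y z.
have fE : f E = 0 := wedge_eulerE a y z.
pose N v := der (a :: s) v /\ f v = 0.
have ob v : der (a :: s) v -> obstruction a v = 0 by move/(der_cons _ _ a0) => [].
have sN v : der s v <-> N (lf a *: v).
  split=> [h|[/(der_cons _ _ a0)[h _] _]]; last exact: der_lf_scale h.
  split; last by case: fl => _ ->; rewrite restr_lf // mul0r.
  apply/der_cons => //; split; first exact: derZ.
  by rewrite obstructionZ restr_lf // mul0r.
(* From a homogeneous basis of the kernel to one of [der s], with degrees
   lowered by 1. *)
have quot x1 x2 D1 D2 : basis3 N E x1 x2 -> vhomog D1 x1 -> vhomog D2 x2 ->
    exists e1 e2 eta1 eta2, [/\ D1 = e1.+1, D2 = e2.+1, basis3 (der s) E eta1 eta2 &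
      vhomog e1 eta1 /\ vhomog e2 eta2].
  move=> bN hx1 hx2; have [_ [dx1 fx1] [dx2 fx2]] := basis3_mem bN.
  have x10 := basis3_neq0 bN; have x20 := basis3_neq0 (basis3_swap bN).
  have [q1 [u1 /(homog_quotient x10 hx1)[e1 [h1' [eta1 [-> he1 ex1]]]]]] :=
    wedge_kernel a0 ya zay (ob _ dx1) fx1.
  have [q2 [u2 /(homog_quotient x20 hx2)[e2 [h2' [eta2 [-> he2 ex2]]]]]] :=
    wedge_kernel a0 ya zay (ob _ dx2) fx2.
  exists e1, e2, eta1, eta2; split=> //; apply: (divide_basis a0 sN).
  have := basis3_shift h2' (basis3_swap (basis3_shift h1' (basis3_swap bN))).
  by rewrite ex1 ex2 [_ *: E + _]addrC addrK [_ *: E + _]addrC addrK.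
have as0 : {in a :: s, forall c, c != 0}.
  by move=> c; rewrite inE => /orP[/eqP ->|/s0].
(* The number of points on [a] relates the exponents of [a :: s] and [s]. *)
have hilb e1 e2 eta1 eta2 k : basis3 (der s) E eta1 eta2 -> vhomog e1 eta1 -> vhomog e2 eta2 ->
    (d1 + d2 + e1 + e2 + size s < k)%N ->
    ('C(k - d1 + 2, 2) + 'C(k - d2 + 2, 2) + k.+1 + npoints a s =
     'C(k - e1 + 2, 2) + 'C(k - e2 + 2, 2) + size s)%N.
  move=> bs he1 he2 ltk; have := @hilbert_cons _ a s k a0 hs sa ltac:(lia).
  rewrite (hilbert_basis3 as0 hb h1 h2); try lia.
  rewrite (hilbert_basis3 s0 bs he1 he2); lia.
have stepC k e : (e < k)%N -> ('C(k - e + 2, 2) = 'C(k - e.+1 + 2, 2) + (k - e + 1))%N.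
  move=> lt; have -> : (k - e + 2 = (k - e.+1 + 2).+1)%N by lia.
  by rewrite bin2D1; lia.
have [f1|f10] := eqVneq (f th1) 0.
  have [f2|f20] := eqVneq (f th2) 0.
    (* Both bivectors vanish: both exponents would drop by 1, whereas the Hilbert
       functions differ by [k + 1 + r - |s|] only. *)
    have bN : basis3 N E th1 th2.
      apply: (basis3_eq _ hb) => v; split=> [|[]//] hv; split=> //.
      case: (hb.1 v).1 => // c0 [c1 [c2 ->]]; case: fl => fD fZ.
      by rewrite !fD !fZ fE f1 f2 !mulr0 !addr0.
    have [e1 [e2 [eta1 [eta2 [ed1 ed2 bs [he1 he2]]]]]] := quot _ _ _ _ bN h1 h2.
    pose k := (d1 + d2 + e1 + e2 + size s).+1.
    have := hilb _ _ _ _ k bs he1 he2 ltac:(lia); have := hilb _ _ _ _ k.+1 bs he1 he2 ltac:(lia).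
    have := stepC k e1; have := stepC k e2; have := stepC k.+1 e1; have := stepC k.+1 e2.
    rewrite -ed1 -ed2; lia.
  (* [th1] is in the kernel: its exponent drops, and [th2] keeps its own. *)
  have bN := kernel_basis a0 fl (basis3_swap hb) fE f20 (g := 0).
  rewrite f1 rmorph0 mul0r scale0r subr0 in bN.
  have h2' : vhomog d2.+1 (lf a *: th2) := vhomogZ (lf_homog a) h2.
  have [e1 [e2 [eta1 [eta2 [[ed1] ed2 bs [he1 he2]]]]]] := quot _ _ _ _ (bN erefl) h2' h1.
  exists e1, e2, eta1, eta2; split=> //.
  pose k := (d1 + d2 + e1 + e2 + size s).+1.
  have := hilb _ _ _ _ k bs he1 he2 ltac:(lia); have := stepC k e2; rewrite -ed1 -ed2; lia.
have [t [u [p ut hu st]]] := representatives (pencil a) s.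
have ts c : c \in t -> c \in s by move=> ct; rewrite (perm_mem p) mem_cat ct.
have dt : distinct_lines [seq trace_on a c | c <- t].
  have tr0 c : c \in t -> trace_on a c != 0 by move=> /ts cs; rewrite trace_on_eq0 // sa.
  have tin c b : c \in t -> b \in t -> (trace_on a b <= trace_on a c)%MS -> b = c.
    move=> ct bt; rewrite -pencil_eq ?sa ?ts // => /eqP.
    exact: (uniq_map_injective ut).
  split.
  - rewrite map_inj_in_uniq; first by move: us; rewrite (perm_uniq p) cat_uniq => /andP[].
    by move=> c b ct bt e; apply: (tin b c) => //; rewrite e submx_refl.
  - by move=> _ /mapP[c ct ->]; apply: tr0.
  by move=> _ _ /mapP[c ct ->] /mapP[b bt ->] h; rewrite (tin c b).
have dv th : der (a :: s) th -> dvdr (\prod_(c <- [seq trace_on a c | c <- t]) lf c) (f th).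
  move=> h; apply: dvdr_prod_distinct => // _ /mapP[c ct ->].
  apply: (dvdr_wedge a0 ya zay); [by apply/sa/ts | exact: ob | ].
  by apply: h; rewrite inE ts ?orbT.
have [_ dth1 dth2] := basis3_mem hb.
have hf1 : f th1 \is d1.+1.-homog := wedge_homog a y z h1.
have hf2 : f th2 \is d2.+1.-homog := wedge_homog a y z h2.
have szt : (d1.+1 <= size [seq trace_on a c | c <- t])%N by rewrite size_map st.
have [g eg] := dvdr_homog_assoc (prod_lf_homog _) hf1 szt f10 (dv _ dth1) (dv _ dth2).
(* The quotient may be replaced by its homogeneous component, so that
   [th2 - g' * th1] is homogeneous. *)
pose g' := pihomog mdeg (d2 - d1) g.
have eg' : f th2 = restr a g' * f th1.
  have rf th : restr a (f th) = f th by exact: restrK.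
  rewrite -[RHS](_ : restr a (g' * f th1) = _); last by rewrite rmorphM /= rf.
  rewrite mulrC -(pihomogM _ _ hf1) addSn subnKC // [f th1 * g]mulrC -eg pihomog_dE //.
have bN := kernel_basis a0 fl hb fE f10 eg'.
have h1' : vhomog d1.+1 (lf a *: th1) := vhomogZ (lf_homog a) h1.
have h2' : vhomog d2 (th2 - g' *: th1).
  apply: vhomogD => //; apply: vhomogN; rewrite -{1}(subnK d12).
  by apply: vhomogZ => //; apply: pihomogP.
have [e1 [e2 [eta1 [eta2 [[ed1] ed2 bs [he1 he2]]]]]] := quot _ _ _ _ bN h1' h2'.
exists e1, e2, eta1, eta2; split=> //.
pose k := (d1 + d2 + e1 + e2 + size s).+1.
have := hilb _ _ _ _ k bs he1 he2 ltac:(lia); have := stepC k e2; rewrite -ed1 -ed2; lia.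
Qed.

(** The addition theorem.  The element [th1] has the degree [e1] of the fixed form
    which divides all obstructions, so its obstruction is zero or divides that
    of [th2]. *)
Lemma addition a s th1 th2 e1 e2 :
  a != 0 -> distinct_lines s -> {in s, forall c, ~~ (c <= a)%MS} ->
  basis3 (der s) E th1 th2 -> vhomog e1 th1 -> vhomog e2 th2 ->
  size s = (npoints a s + e1)%N ->
  exists x y : V, basis3 (der (a :: s)) E x y.
Proof.
move=> a0 hs sa hb h1 h2 szs.
have fl := obstruction_restr_linear a; have fE := obstruction_euler a0.
suff [x [y hxy]] : exists x y : V, basis3 (fun v => der s v /\ obstruction a v = 0) E x y.
  by exists x, y; apply: basis3_eq hxy => v; rewrite der_cons.
have [f1|f10] := eqVneq (obstruction a th1) 0.
  have [f2|f20] := eqVneq (obstruction a th2) 0; last first.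
    do 2!eexists; apply: (kernel_basis a0 fl (basis3_swap hb) fE f20 (g := 0)).
    by rewrite f1 rmorph0 mul0r.
  exists th1, th2; apply: (basis3_eq _ hb) => v; split=> [|[]//] hv; split=> //.
  case: (hb.1 v).1 => // c0 [c1 [c2 ->]]; case: fl => fD fZ.
  by rewrite !fD !fZ fE f1 f2 !mulr0 !addr0.
have [t [u [p ut hu st]]] := representatives (pencil a) s.
have szu : size [seq trace_on a c | c <- u] = e1.
  by apply/eqP; rewrite size_map -(eqn_add2l (npoints a s)) -szs (perm_size p) size_cat st.
have dv th : der s th -> dvdr (\prod_(c <- [seq trace_on a c | c <- u]) lf c) (obstruction a th).
  by rewrite big_map; apply: dvdr_obstruction p hu.
have [_ dth1 dth2] := basis3_mem hb.
have hf1 : obstruction a th1 \is e1.-homog by apply/restr_homog/ev_homog.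
have := dvdr_homog_assoc (prod_lf_homog _) hf1 _ f10 (dv _ dth1) (dv _ dth2).
rewrite szu => /(_ (leqnn _))[g eg].
do 2!eexists; apply: (kernel_basis a0 fl hb fE f10 (g := g)).
by rewrite -[LHS](restrK _ a0) -/(obstruction a th2) eg rmorphM /= restrK.
Qed.
End AdditionDeletion.

(** * Homogeneous bases *)

Section Homogeneous.
Variable K : fieldType.
Notation S := {mpoly K[3]}.
Notation V := 'rV[S]_3.
Implicit Types (F G : S) (M : V -> Prop) (d : nat).

Lemma mpoly_const_split F :
  exists g : 'I_3 -> S, F = (F@_0)%:MP + \sum_i 'X_i * g i.
Proof.
elim/mpolyind: F => [|c m F _ _ [g eg]].
  by exists (fun=> 0); rewrite mcoeff0 mpolyC0 big1 ?addr0 // => i _; rewrite mulr0.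
have [g' eg'] : exists g : 'I_3 -> S, 'X_[m] = ('X_[m]@_0)%:MP + \sum_i 'X_i * g i.
  have [->|m0] := eqVneq m 0%MM.
    exists (fun=> 0); rewrite mcoeffX eqxx mpolyX0 big1 ?addr0 // => i _.
    by rewrite mulr0.
  have [i0 mi0] : exists i, m i != 0%N.
    apply/existsP; apply: contraNT m0; rewrite negb_exists => /forallP h.
    by apply/eqP/mnmP => i; rewrite mnm0E; apply/eqP; move: (h i); rewrite negbK.
  exists (fun i => if i == i0 then 'X_[m - U_(i0)] else 0).
  rewrite mcoeffX (negbTE m0) mpolyC0 add0r (bigD1 i0) //= eqxx big1 ?addr0.
    by rewrite mulrC -mpolyXD submK // lep1mP.
  by move=> i /negbTE ->; rewrite mulr0.
exists (fun i => c *: g' i + g i).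
rewrite {1}eg' {1}eg linearP /= mpolyCD mpolyCM -mul_mpolyC mulrDr addrACA; congr (_ + _).
rewrite mulr_sumr -big_split /=; apply: eq_bigr => i _.
by rewrite mulrDr mulrCA -mul_mpolyC.
Qed.

Lemma vpi_partition (v : V) : exists N0, forall N, (N0 <= N)%N -> v = \sum_(d < N) vpi d v.
Proof.
exists (\max_(i < 3) msize (v ord0 i)) => N leN; apply/rowP => i; rewrite summxE.
rewrite [LHS](@pihomog_partitionE _ _ mdeg N).
  by apply: eq_bigr => d _; rewrite mxE.
by apply: leq_trans leN; apply: (leq_bigmax i).
Qed.

Lemma vpi_mulX i d (v : V) : vpi d.+1 ('X_i *: v) = 'X_i *: vpi d v.
Proof.
apply/rowP => j; rewrite !mxE; apply: (@pihomogM _ _ 1).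
by rewrite dhomogX /= mdeg1.
Qed.

Lemma vpi0_mulX i (v : V) : vpi 0 ('X_i *: v) = 0.
Proof.
apply/rowP => j; rewrite !mxE; apply: (@pihomogM_lt _ _ 1) => //.
by rewrite dhomogX /= mdeg1.
Qed.

Lemma comb_mulmx m (e : 'I_m -> V) (c : 'rV[S]_m) :
  c *m (\matrix_i e i) = \sum_i c 0 i *: e i.
Proof. by rewrite mulmx_sum_row; apply: eq_bigr => i _; rewrite rowK. Qed.

Lemma is_basisP M m (e : 'I_m -> V) : is_basis M e <->
  (forall v, M v <-> exists c : 'rV[S]_m, v = c *m \matrix_i e i) /\
  (forall c : 'rV[S]_m, c *m \matrix_i e i = 0 -> c = 0).
Proof.
have cE (c : 'I_m -> S) : (\row_i c i) *m \matrix_i e i = \sum_i c i *: e i.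
  by rewrite comb_mulmx; apply: eq_bigr => i _; rewrite mxE.
split=> -[gen free]; split=> [v|c].
- rewrite gen; split=> -[c ->]; first by exists (\row_i c i).
  by exists (c 0); rewrite comb_mulmx.
- by rewrite comb_mulmx => /free h; apply/rowP => i; rewrite h mxE.
- rewrite gen; split=> -[c ->]; last by exists (\row_i c i).
  by exists (c 0); rewrite comb_mulmx.
by rewrite -cE => /free /rowP h i; have := h i; rewrite !mxE.
Qed.

(** The homogeneous components of the basis elements generate the module; those
    picked by an invertible minor of their matrix of constant terms still do, by
    the graded Nakayama lemma, and they are as many as the basis elements. *)
Lemma homogeneous_basis M m (e : 'I_m -> V) :
  is_basis M e -> (forall d v, M v -> M (vpi d v)) ->
  exists (f : 'I_m -> V) (df : 'I_m -> nat),
    is_basis M f /\ forall i, vhomog (df i) (f i).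
Proof.
move=> be Mgr; have Me i := is_basis_mem i be.
move/is_basisP: be => [gen free]; set Em := \matrix_i e i in gen free.
have [N eN] : exists N, forall i, e i = \sum_(d < N) vpi d (e i).
  have /fin_all_exists[N0 hN0] i := vpi_partition (e i).
  by exists (\max_i N0 i)%N => i; apply/hN0/leq_bigmax.
pose T := ('I_m * 'I_N)%type.
have /fin_all_exists[C eC] (x : T) : exists c : 'rV[S]_m, vpi x.2 (e x.1) = c *m Em.
  by apply/gen/Mgr/Me.
pose C0 : 'M[K]_(#|{: T}|, m) := \matrix_(x, j) (C (enum_val x) 0 j)@_0.
have C1 i : \sum_(d < N) C (i, d) = delta_mx 0 i.
  apply/eqP; rewrite -subr_eq0; apply/eqP/free.
  rewrite mulmxBl -rowE rowK mulmx_suml eN; apply/eqP; rewrite subr_eq0; apply/eqP.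
  by apply: eq_bigr => d _; rewrite -eC.
(* The components of [e i] add up to [e i], so the rows of [C0] span. *)
have C0full : row_full C0.
  apply/row_fullP; exists (\matrix_(i, x) (i == (enum_val x).1)%:R).
  apply/matrixP => i j; rewrite !mxE (reindex_onto enum_rank enum_val) /=; last first.
    by move=> x _; rewrite enum_valK.
  under eq_bigl => x do rewrite enum_rankK eqxx.
  under eq_bigr => x _ do rewrite !mxE enum_rankK.
  transitivity (\sum_(x : T) (i == x.1)%:R * (C (x.1, x.2) 0 j)@_0).
    by apply: eq_bigr => -[].
  rewrite -(pair_bigA _ (fun (i' : 'I_m) (d : 'I_N) => (i == i')%:R * (C (i', d) 0 j)@_0)) /=.
  rewrite (bigD1 i) //= [X in _ + X]big1 ?addr0 => [|i' ne]; last first.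
    by apply: big1 => d _; rewrite eq_sym (negbTE ne) mul0r.
  under eq_bigr => d _ do rewrite eqxx mul1r.
  have /rowP/(_ j) := C1 i; rewrite summxE mxE eqxx /= => /(congr1 (mcoeff 0)).
  by rewrite raddf_sum /= => ->; rewrite eq_sym; case: eqP => _; rewrite ?mcoeff1 ?eqxx ?mcoeff0.
pose sel k : T := enum_val (fullrankfun C0full k).
pose f k := vpi (sel k).2 (e (sel k).1).
pose P : 'M[S]_m := \matrix_k C (sel k).
have fP : \matrix_k f k = P *m Em.
  by apply/row_matrixP => k; rewrite row_mul !rowK -eC.
pose Q : 'M[K]_m := invmx (rowsub (fullrankfun C0full) C0).
pose Qs : 'M[S]_m := map_mx (@mpolyC 3 K) Q.
(* The selected components, changed by the constant matrix [Q], agree with the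
   basis [e] modulo the irrelevant ideal. *)
have QP i j : ((Qs *m P) i j)@_0 = (i == j)%:R.
  have /matrixP/(_ i j) := mulVmx (fullrowsub_unit C0full); rewrite !mxE => <-.
  by rewrite raddf_sum /=; apply: eq_bigr => k _; rewrite !mxE mul_mpolyC mcoeffZ.
have fh k : vhomog (sel k).2 (f k) by apply: vpi_homog.
pose M' v := exists c : 'rV[S]_m, v = c *m \matrix_k f k.
have M'D v w : M' v -> M' w -> M' (v + w).
  by move=> [c ->] [c' ->]; exists (c + c'); rewrite mulmxDl.
have M'Z F v : M' v -> M' (F *: v).
  by move=> [c ->]; exists (F *: c); rewrite scalemxAl.
have M'0 : M' 0 by exists 0; rewrite mul0mx.
have M'vpi d v : M' v -> M' (vpi d v).
  move=> [c ->]; rewrite comb_mulmx vpi_sum; elim/big_ind: _ => // k _.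
  have [lt|le] := ltnP d (sel k).2; first by rewrite (vpiZ_lt _ (fh k) lt).
  rewrite -(subnKC le) (vpiZ _ _ (fh k)); apply: M'Z.
  by exists (delta_mx 0 k); rewrite -rowE rowK.
have /fin_all_exists[G eG] (x : 'I_m * 'I_m) : exists g : 'I_3 -> S,
    (Qs *m P - 1%:M) x.1 x.2 = \sum_i 'X_i * g i.
  have [g eg] := mpoly_const_split ((Qs *m P - 1%:M) x.1 x.2); exists g; rewrite {1}eg.
  rewrite [_@_0](_ : _ = 0) ?mpolyC0 ?add0r //.
  move: (Qs *m P) (QP x.1 x.2) => A q; rewrite mxE mcoeffD q !mxE mcoeffN.
  by case: eqP => _; rewrite ?mcoeff1 ?mcoeff0 ?eqxx subrr.
pose Gm i : 'M[S]_m := \matrix_(k, l) G (k, l) i.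
have eR : Qs *m P = 1%:M + \sum_i 'X_i *: Gm i.
  apply/eqP; rewrite addrC -subr_eq; apply/eqP/matrixP => k l.
  by rewrite (eG (k, l)) summxE; apply: eq_bigr => i _; rewrite !mxE.
have homM' d v : vhomog d v -> M v -> M' v.
  have split_v c : exists2 w, M' w & c *m Em = w - \sum_i 'X_i *: (c *m Gm i *m Em).
    exists ((c *m Qs) *m (\matrix_k f k)); first by exists (c *m Qs).
    rewrite fP mulmxA -(mulmxA c) eR mulmxDr mulmx1 mulmxDl -addrA -[LHS]addr0; congr (_ + _).
    rewrite mulmx_sumr mulmx_suml; apply/esym/eqP; rewrite subr_eq0; apply/eqP/eq_bigr => i _.
    by rewrite -scalemxAr -scalemxAl.
  elim: d v => [|d ih] v hv /gen[c ev]; have [w Mw ew] := split_v c;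
    rewrite -(vpi_id hv) ev ew vpiD.
    rewrite (_ : vpi 0 (- _) = 0) ?addr0; first exact: M'vpi.
    rewrite -sumrN vpi_sum big1 // => i _; rewrite -scalerN; exact: vpi0_mulX.
  apply: (M'D); first exact: M'vpi.
  rewrite -sumrN vpi_sum; apply: (big_ind _ M'0 M'D) => i _.
  rewrite -scalerN vpi_mulX; apply/M'Z/ih; first exact: vpi_homog.
  by apply/Mgr/gen; exists (- (c *m Gm i)); rewrite mulNmx.
have MM' v : M v -> M' v.
  move=> Mv; have [n /(_ n (leqnn n)) ->] := vpi_partition v.
  by elim/big_ind: _ => // d _; apply: (homM' d); [apply: vpi_homog | apply: Mgr].
exists f, (fun k => (sel k).2); split=> //; apply/is_basisP; split=> [v|c cf].
  split=> [/MM' //|[c ->]]; apply/gen; exists (c *m P).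
  by rewrite fP mulmxA.
have [P' eP'] : exists P' : 'M[S]_m, P' *m P = 1%:M.
  have /fin_all_exists[D eD] i : exists c : 'rV[S]_m, e i = c *m \matrix_k f k by apply/MM'/Me.
  exists (\matrix_i D i); apply/row_matrixP => i; rewrite row_mul rowK row1.
  apply/eqP; rewrite -subr_eq0; apply/eqP/free.
  by rewrite mulmxBl -mulmxA -fP -eD -rowE rowK subrr.
have cP : c *m P = 0 by apply: free; rewrite -mulmxA -fP.
by rewrite -[c]mulmx1 -(mulmx1C eP') mulmxA cP mul0mx.
Qed.

End Homogeneous.

(** * Syzygies and derivations *)

Section Syzygies.
Variable K : fieldType.
Hypothesis char0 : [pchar K] =i pred0.
Notation S := {mpoly K[3]}.
Notation V := 'rV[S]_3.
Notation E := (euler K 3).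
Implicit Types (F G h : S) (M : V -> Prop) (v w th : V) (d : nat) (a b : 'rV[K]_3)
  (s : seq 'rV[K]_3).

Definition apply_der v F : S := \sum_(i < 3) v 0 i * F^`M(i).

Lemma apply_derD v w F : apply_der (v + w) F = apply_der v F + apply_der w F.
Proof. by rewrite -big_split; apply: eq_bigr => i _; rewrite mxE mulrDl. Qed.

Lemma apply_derZ h v F : apply_der (h *: v) F = h * apply_der v F.
Proof. by rewrite mulr_sumr; apply: eq_bigr => i _; rewrite mxE mulrA. Qed.

Lemma apply_der0 F : apply_der 0 F = 0.
Proof. by rewrite /apply_der big1 // => i _; rewrite mxE mul0r. Qed.

Lemma apply_derN v F : apply_der (- v) F = - apply_der v F.
Proof. by rewrite -scaleN1r apply_derZ mulN1r. Qed.

Lemma apply_derM v F G :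
  apply_der v (F * G) = apply_der v F * G + F * apply_der v G.
Proof.
rewrite /apply_der mulr_suml mulr_sumr -big_split; apply: eq_bigr => i _ /=.
by rewrite mderivM; ring.
Qed.

Lemma mderiv_lf b i : (lf b)^`M(i) = (b 0 i)%:MP.
Proof.
rewrite /lf linear_sum /= (bigD1 i) //= big1 ?addr0 => [|j ji].
  rewrite linearZ /= mderivX mnmE eqxx scale1r -mul_mpolyC.
  by rewrite (_ : (U_(i) - U_(i))%MM = 0%MM) ?mpolyX0 ?mulr1 //; apply/mnmP => j; rewrite mnmBE subnn mnm0E.
by rewrite linearZ /= mderivX mnmE (negbTE ji) scale0r scaler0.
Qed.

Lemma apply_der_lf v b : apply_der v (lf b) = ev b v.
Proof. by apply: eq_bigr => i _; rewrite mderiv_lf mulrC mul_mpolyC. Qed.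

Lemma mderiv_homog d F i : F \is d.+1.-homog -> F^`M(i) \is d.-homog.
Proof.
move=> /dhomogP hF; rewrite [F]mpolyE linear_sum /= big_seq; apply: rpred_sum => m mF.
rewrite linearZ /= mderivX.
have [->|mi] := eqVneq (m i) 0%N; first by rewrite scale0r scaler0 rpred0.
do 2!apply: rpredZ; rewrite dhomogX /=.
have : mdeg (m - U_(i) + U_(i)) = d.+1 by rewrite submK ?lep1mP // hF.
by rewrite mdegD mdeg1 addn1 => -[->].
Qed.

Definition forms_prod s : S := \prod_(b <- s) lf b.

Definition syz s v : Prop := apply_der v (forms_prod s) = 0.

Lemma perm_syz s t v :
  perm_eq s t -> syz s v <-> syz t v.
Proof. by move=> p; rewrite /syz /forms_prod (perm_big _ p). Qed.

Lemma euler_forms_prod s : apply_der E (forms_prod s) = (size s)%:R * forms_prod s.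
Proof.
rewrite /forms_prod; elim: s => [|b s ih].
  rewrite big_nil mul0r /apply_der big1 // => i _.
  by rewrite -mpolyC1 mderivC mulr0.
rewrite big_cons apply_derM ih apply_der_lf ev_euler /= -natr1; ring.
Qed.

(** Each form divides the product, but not the product of the other forms. *)
Lemma syz_der s v : distinct_lines s -> syz s v -> der s v.
Proof.
move=> [us s0 ds] h b bs; have b0 := s0 b bs.
have : dvdr (lf b) (ev b v * forms_prod (rem b s)).
  exists (- apply_der v (forms_prod (rem b s))); apply/eqP.
  rewrite mulrN -addr_eq0 -apply_der_lf -apply_derM; apply/eqP.
  by rewrite -[RHS]h /forms_prod (perm_big _ (perm_to_rem bs)) big_cons.
case/(lf_prime b0) => // /(dvdr_lf_prod b0)[c cs].
move/(ds _ _ bs (mem_rem cs)) => cb; move: cs; rewrite cb.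
by rewrite mem_rem_uniq // inE eqxx.
Qed.

(** If [v] multiplies the product of the forms by [g], then so does
    [(g / n) * euler], where [n] is the number of lines. *)
Lemma der_syz s v : (0 < size s)%N -> der s v -> exists h, syz s (v - h *: E).
Proof.
move=> s0 hv; have [g eg] : exists g, apply_der v (forms_prod s) = g * forms_prod s.
  elim: s hv {s0} => [|b s ih] hv.
    exists 0; rewrite mul0r /apply_der big1 // => i _.
    by rewrite /forms_prod big_nil -mpolyC1 mderivC mulr0.
  have [|g eg] := ih; first by move=> c cs; apply: hv; rewrite inE cs orbT.
  have [q eq] := hv b (mem_head _ _); exists (q + g).
  by rewrite /forms_prod big_cons apply_derM -/(forms_prod s) eg apply_der_lf eq; ring.
have n0 : (size s)%:R != 0 :> K.
  by rewrite ((pcharf0P K).1 char0) -lt0n.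
exists ((size s)%:R^-1%:MP * g); rewrite /syz apply_derD apply_derN apply_derZ.
rewrite eg euler_forms_prod; apply/eqP; rewrite subr_eq0; apply/eqP.
have -> : (size s)%:R = ((size s)%:R : K)%:MP :> S by rewrite rmorph_nat.
set n1 := (_%:R^-1)%:MP; set n2 := _%:MP.
have -> : n1 * g * (n2 * forms_prod s) = (n1 * n2) * (g * forms_prod s) by ring.
by rewrite -mpolyCM mulVf // mpolyC1 mul1r.
Qed.

Lemma forms_prod_neq0 s : distinct_lines s -> forms_prod s != 0.
Proof. by case=> _ s0 _; apply: prod_lf_neq0. Qed.

Lemma syz_euler s h : distinct_lines s -> (0 < size s)%N -> syz s (h *: E) -> h = 0.
Proof.
move=> hs s0; rewrite /syz apply_derZ euler_forms_prod => /eqP.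
rewrite !mulf_eq0 (negbTE (forms_prod_neq0 hs)) orbF => /orP[/eqP //|].
have -> : (size s)%:R = ((size s)%:R : K)%:MP :> S by rewrite rmorph_nat.
rewrite mpolyC_eq0 ((pcharf0P K).1 char0) => /eqP e; by rewrite e in s0.
Qed.

Lemma syzD s v w : syz s v -> syz s w -> syz s (v + w).
Proof. by rewrite /syz apply_derD => -> ->; rewrite addr0. Qed.

Lemma syzZ s h v : syz s v -> syz s (h *: v).
Proof. by rewrite /syz apply_derZ => ->; rewrite mulr0. Qed.

Lemma syz_vpi s d v : (0 < size s)%N -> syz s v -> syz s (vpi d v).
Proof.
case: s => // b s _; rewrite /syz => h.
have hF : forms_prod (b :: s) \is (size s).+1.-homog by apply: (prod_lf_homog (b :: s)).
transitivity (pihomog mdeg (size s + d) (apply_der v (forms_prod (b :: s)))); last by rewrite h linear0.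
rewrite linear_sum; apply: eq_bigr => i _; rewrite mxE /= mulrC.
by rewrite -(pihomogM _ _ (mderiv_homog i hF)) [v 0 i * _]mulrC.
Qed.

(** Splitting off the Euler field: [der s] is the direct sum of the multiples
    of the Euler field and of the syzygies of the gradient of the product of
    the forms. *)
Lemma der_basis s m (e : 'I_m -> V) :
  distinct_lines s -> (0 < size s)%N -> is_basis (syz s) e ->
  is_basis (der s) (fun i : 'I_m.+1 => if unlift ord0 i is Some j then e j else E).
Proof.
move=> hs s0 be; have Se i := is_basis_mem i be; have [gen free] := be.
have sumE (c : 'I_m.+1 -> S) : \sum_i c i *: (if unlift ord0 i is Some j then e j else E) =
    c ord0 *: E + \sum_j c (lift ord0 j) *: e j.
  rewrite big_ord_recl unlift_none; congr (_ + _); apply: eq_bigr => j _.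
  by rewrite liftK.
have Ssum (c : 'I_m -> S) : syz s (\sum_j c j *: e j) by apply/gen; exists c.
split=> [v|c]; last first.
  rewrite sumE => c0; have c00 : c ord0 = 0.
    apply: (syz_euler hs s0); have -> : c ord0 *: E = (-1) *: \sum_j c (lift ord0 j) *: e j.
      by apply/eqP; rewrite scaleN1r -addr_eq0 c0.
    exact/syzZ.
  move: c0; rewrite c00 scale0r add0r => /free h i.
  by case: (unliftP ord0 i) => [j ->|->].
split=> [/(der_syz s0)[h /gen[c ec]]|[c ->]].
  exists (fun i => if unlift ord0 i is Some j then c j else h); rewrite sumE unlift_none.
  rewrite -[v](subrK (h *: E)) ec addrC; congr (_ + _); apply: eq_bigr => j _.
  by rewrite liftK.
rewrite sumE; apply: derD; first exact/derZ/der_euler.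
exact: syz_der.
Qed.

Lemma syz_basis s x y :
  distinct_lines s -> (0 < size s)%N -> basis3 (der s) E x y ->
  exists e : 'I_2 -> V, is_basis (syz s) e.
Proof.
move=> hs s0 hb; have [_ dx dy] := basis3_mem hb.
have [h1 sx] := der_syz s0 dx; have [h2 sy] := der_syz s0 dy.
have {hb} := basis3_shift h2 (basis3_swap (basis3_shift h1 (basis3_swap hb))).
move: sx sy; move: (x - _) (y - _) => {dx dy h1 h2 x y} x y sx sy [gen free].
exists (fun i => if i == ord0 then x else y).
have sumE (c : 'I_2 -> S) : \sum_i c i *: (if i == ord0 then x else y) =
    c ord0 *: x + c (lift ord0 ord0) *: y by rewrite !big_ord_recl big_ord0 addr0.
split=> [v|c]; last first.
  rewrite sumE => c0; have [|_ h h'] := free 0 (c ord0) (c (lift ord0 ord0)).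
    by rewrite scale0r add0r.
  by move=> i; case: (unliftP ord0 i) => [j ->|->//]; rewrite ord1.
split=> [sv|[c ->]]; last by rewrite sumE; apply: syzD; apply: syzZ.
have /gen[c0 [c1 [c2 ev]]] := syz_der hs sv.
have c00 : c0 = 0.
  apply: (syz_euler hs s0); have -> : c0 *: E = v + (-1) *: (c1 *: x + c2 *: y).
    by rewrite ev scaleN1r -[c0 *: E + _ + _]addrA addrK.
  by apply/syzD => //; apply/syzZ/syzD; apply: syzZ.
exists (fun i => if i == ord0 then c1 else c2); rewrite sumE /= ev c00.
by rewrite scale0r add0r.
Qed.

End Syzygies.

(** * Dependence on the incidences *)

Section Combinatorics.
Variable K : fieldType.
Notation S := {mpoly K[3]}.
Notation V := 'rV[S]_3.
Notation E := (euler K 3).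
Implicit Types (M : V -> Prop) (a b c : 'rV[K]_3) (s t : seq 'rV[K]_3) (psi : 'rV[K]_3 -> 'rV[K]_3).

Lemma distinct_cons b s : distinct_lines (b :: s) ->
  [/\ b != 0, distinct_lines s & {in s, forall c, ~~ (c <= b)%MS}].
Proof.
move=> [/= /andP[bs us] s0 ds]; split; first by rewrite s0 ?mem_head.
  split=> // [c cs|c d cs ds']; first by rewrite s0 // inE cs orbT.
  by apply: ds; rewrite inE ?cs ?ds' orbT.
move=> c cs; apply: contraNN bs => cb.
by rewrite -(ds b c _ _ cb) // inE ?eqxx ?cs ?orbT.
Qed.

Definition same_incidence psi s : Prop :=
  {in s & &, forall x y z, (z <= x + y)%MS = (psi z <= psi x + psi y)%MS}.

Lemma same_incidence_cons psi b s : same_incidence psi (b :: s) -> same_incidence psi s.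
Proof. by move=> h x y z xs ys zs; apply: h; rewrite inE (xs, ys, zs) orbT. Qed.

Lemma npoints_map psi b s :
  distinct_lines (b :: s) -> distinct_lines [seq psi c | c <- b :: s] ->
  same_incidence psi (b :: s) -> npoints (psi b) [seq psi c | c <- s] = npoints b s.
Proof.
move=> /distinct_cons[b0 _ bs] /distinct_cons[pb0 _ pbs] inc.
rewrite /npoints -map_comp; apply: size_undup_map => x y xs ys /=.
have pxs := pbs _ (map_f psi xs); have pys := pbs _ (map_f psi ys).
have -> : (pencil (psi b) (psi x) == pencil (psi b) (psi y)) = (psi x <= psi b + psi y)%MS.
  by rewrite pencil_eq // trace_on_sub.
rewrite pencil_eq ?bs // trace_on_sub ?bs //.
by rewrite -inc // inE ?eqxx ?xs ?ys ?orbT.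
Qed.

(** Adding the lines one by one, only the numbers of points on the new lines
    matter, and these are determined by the incidences. *)
Lemma hilbert_same_incidence psi s k :
  distinct_lines s -> distinct_lines [seq psi c | c <- s] -> same_incidence psi s ->
  (size s <= k)%N -> \dim (der_part s k) = \dim (der_part [seq psi c | c <- s] k).
Proof.
elim: s => [|b s ih] // dbs dpbs inc /ltnW szk.
have [b0 ds bs] := distinct_cons dbs; have [pb0 dps pbs] := distinct_cons dpbs.
have e1 := hilbert_cons b0 ds bs (leqW szk).
have e2 := @hilbert_cons _ (psi b) [seq psi c | c <- s] k pb0 dps pbs.
rewrite size_map (npoints_map dbs dpbs inc) in e2; have := e2 (leqW szk).
rewrite -(ih ds dps (same_incidence_cons inc) szk) -e1 map_cons.
by move/eqP; rewrite !eqn_add2r => /eqP.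
Qed.

Lemma der_basis3 M (e : 'I_2 -> V) :
  is_basis M (fun i : 'I_3 => if unlift ord0 i is Some j then e j else E) ->
  basis3 M E (e ord0) (e ord_max).
Proof.
move=> [gen free]; apply/basis3_is_basis.
have eE (i : 'I_3) : (if unlift ord0 i is Some j then e j else E) =
    [:: E; e ord0; e ord_max]`_i.
  case: (unliftP ord0 i) => [j ->|->] //; case: j => -[|[|//]] lt /=.
    by congr e; apply: val_inj.
  by congr e; apply: val_inj.
split=> [v|c].
  rewrite gen; split=> -[c ->]; exists c; apply: eq_bigr => i _; first by rewrite eE.
  by rewrite -eE.
by move=> e0; apply: free; rewrite -[RHS]e0; apply: eq_bigr => i _; rewrite eE.
Qed.

(** The heart of the argument: deletion for [a :: s], comparison of the Hilbert
    functions of [s] and of its image, addition for the image.  The hypothesis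
    that freeness passes from [s] to its image is what minimality provides. *)
Lemma free_transfer psi a s d1 d2 (th : 'I_2 -> V) :
  [pchar K] =i pred0 ->
  distinct_lines (a :: s) -> distinct_lines [seq psi c | c <- a :: s] ->
  same_incidence psi (a :: s) ->
  is_basis (syz (a :: s)) th -> vhomog d1 (th ord0) -> vhomog d2 (th ord_max) -> (d1 <= d2)%N -> (d1 < npoints a s)%N ->
  ((exists e : 'I_2 -> V, is_basis (syz s) e) ->
     exists m (e : 'I_m -> V), is_basis (syz [seq psi c | c <- s]) e) ->
  exists e : 'I_2 -> V, is_basis (syz [seq psi c | c <- a :: s]) e.
Proof.
move=> char0 das dpas inc hb h1 h2 d12 ltr transfer.
have [a0 ds sa] := distinct_cons das; have [pa0 dps psa] := distinct_cons dpas.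
have s_gt0 : (0 < size s)%N.
  by case: (s) ltr => //; rewrite /npoints ltn0.
have b3 := der_basis3 (der_basis char0 das isT hb).
have [e1 [e2 [eta1 [eta2 [bs he1 he2 szs]]]]] := deletion a0 ds sa b3 h1 h2 d12 ltr.
have [m [e be]] := transfer (syz_basis char0 ds s_gt0 bs).
set s' := [seq psi c | c <- s] in be dps psa *.
have szs' : size s' = size s by rewrite size_map.
have s'_gt0 : (0 < size s')%N by rewrite szs'.
have [f [df [bf hf]]] := homogeneous_basis be (fun d v => @syz_vpi _ _ d v s'_gt0).
have bdf := der_basis char0 dps s'_gt0 bf.
pose df' (i : 'I_m.+1) := if unlift ord0 i is Some j then df j else 1%N.
have hdf i : vhomog (df' i) (if unlift ord0 i is Some j then f j else E).
  by rewrite /df'; case: unlift => [j|]; [apply: hf | apply: euler_homog].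
have [_ s0 _] := ds; have [_ s'0 _] := dps.
have [K0 hilb] : exists K0, forall k, (K0 <= k)%N ->
    (\sum_(i < m) 'C(k - df i + 2, 2) = 'C(k - e1 + 2, 2) + 'C(k - e2 + 2, 2))%N.
  exists (size s + e1 + e2 + \sum_i df i).+1 => k lek.
  have szk : (size s <= k)%N by lia.
  have := hilbert_same_incidence ds dps (same_incidence_cons inc) szk.
  rewrite (hilbert_basis3 s0 bs he1 he2); try lia.
  rewrite (hilbert_basis s'0 bdf hdf) => [|i].
    rewrite big_ord_recl /df' unlift_none => /eqP; rewrite eqn_add2l => /eqP ->.
    by apply: eq_bigr => i _; rewrite liftK.
  rewrite /df'; case: unlift => [j|]; last by lia.
  by apply: leq_trans lek; rewrite (bigD1 j) //=; lia.
have m2 := hilbert_rank hilb; move: f df bf hf bdf hilb {e be hdf df'}; rewrite {}m2.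
move=> f df bf hf /der_basis3 bdf hilb.
have hexp k : (K0 <= k)%N -> ('C(k - df ord0 + 2, 2) + 'C(k - df ord_max + 2, 2) =
    'C(k - e1 + 2, 2) + 'C(k - e2 + 2, 2))%N.
  move=> /hilb <-; rewrite !big_ord_recl big_ord0 addn0; congr (_ + 'C(_ - df _ + _, _))%N.
  exact: val_inj.
suff [x [y bxy]] : exists x y : V, basis3 (der (psi a :: s')) E x y.
  exact: (syz_basis char0 dpas (ltn0Sn _) bxy).
have szs2 : size s' = (npoints (psi a) s' + e2)%N by rewrite szs' npoints_map.
have [[_ ed]|[ed _]] := hilbert_exponents hexp.
  by apply: (addition pa0 dps psa (basis3_swap bdf) _ (hf ord0)) szs2; rewrite -ed.
by apply: (addition pa0 dps psa bdf _ (hf ord_max)) szs2; rewrite -ed.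
Qed.

End Combinatorics.

(** * Lines and intersection lattices *)

#[local] Opaque line.

Section Lattice.
Variable R : realType.
Notation C := R[i]%C.
Implicit Types (a b c x y z : 'rV[C]_3) (A B : arrangement R) (s t : seq 'rV[C]_3).

Lemma lineP a (v : 'rV[C]_3) : reflect (a *m v^T = 0) (v \in line a).
Proof.
rewrite mem_line; have -> : \sum_(i < 3) a 0 i * v 0 i = (a *m v^T) 0 0.
  by rewrite mxE; apply: eq_bigr => i _; rewrite mxE.
apply: (iffP eqP) => [h|->]; last by rewrite mxE.
by apply/matrixP => i j; rewrite !ord1 h mxE.
Qed.

(** Projective duality: the columns of the cokernel of [a + b] are points of
    both lines. *)
Lemma line_capE a b c : (line a :&: line b <= line c)%VS = (c <= a + b)%MS.
Proof.
apply/subvP/idP => [h|/sub_addsmxP[[u v] /= ->] w]; last first.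
  case/memv_capP => /lineP wa /lineP wb; apply/lineP.
  by rewrite mulmxDl -!mulmxA wa wb !mulmx0 addr0.
rewrite submxE; apply/eqP/matrixP => i j; rewrite ord1.
pose w : 'rV[C]_3 := (col j (cokermx (a + b)%MS))^T.
have hw d : (d <= a + b)%MS -> w \in line d.
  rewrite submxE => /eqP d0; apply/lineP.
  by rewrite /w trmxK colE mulmxA d0 mul0mx.
have /lineP : w \in line c.
  by apply/h/memv_capP; split; apply: hw; [apply: addsmxSl | apply: addsmxSr].
rewrite /w trmxK colE mulmxA => /matrixP/(_ 0 0).
by rewrite -colE !mxE.
Qed.

Lemma line_sub a b : (line a <= line b)%VS = (b <= a)%MS.
Proof.
by rewrite -[line a]capvv line_capE (addsmx_idPl (submx_refl a) : (a + a :=: a)%MS).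
Qed.

Lemma line_eq a b : b != 0 -> (line a == line b) = (b <= a)%MS.
Proof.
move=> b0; apply/idP/idP => [/eqP e|h]; first by rewrite -line_sub e subvv.
apply/eqP/subv_anti/andP; split; apply: etrans (line_sub _ _) _; first exact: h.
exact: submx_rV_sym.
Qed.

Lemma forms_distinct A : distinct_lines (forms A).
Proof.
have nz : {in forms A, forall b, b != 0} by move=> b /(allP (forms_neq0 A)).
split=> //; first exact: (map_uniq (lines_uniq A)).
move=> b c bA cA cb; have inj := uniq_map_injective (lines_uniq A).
by apply/esym/(inj b c bA cA)/eqP; rewrite line_eq; [exact: cb | apply: nz].
Qed.

Lemma sub_arrangement s : distinct_lines s -> exists A : arrangement R, forms A = s.
Proof.
move=> [us s0 ds].
have h1 : all (fun a => a != 0) s by apply/allP.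
have h2 : uniq [seq line a | a <- s].
  rewrite (map_inj_in_uniq _) => [|x y xs ys /eqP]; first exact: us.
  by rewrite line_eq ?s0 // => /(ds _ _ xs ys).
by exists (Arrangement h1 h2).
Qed.

Lemma D0_syz A v : D0 A v <-> syz (forms A) v.
Proof. by []. Qed.

Lemma dimv2_cap (U W : {vspace 'rV[C]_3}) :
  \dim U = 2%N -> \dim W = 2%N -> ~~ (U <= W)%VS -> \dim (U :&: W) = 1%N.
Proof.
move=> dU dW UW; have := dimv_sum_cap U W; rewrite dU dW => e.
have lt : (\dim (U :&: W) < \dim U)%N.
  rewrite ltn_neqAle dimvS ?capvSl // andbT; apply: contraNneq UW => eU.
  have /eqP <- : (U :&: W == U)%VS by rewrite eqEdim capvSl eU /=.
  exact: capvSr.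
have : (\dim (U + W) <= 3)%N by apply: leq_trans (dimvS (subvf _)) _; rewrite dimvf.
by move: lt; rewrite dU; lia.
Qed.

Lemma dim_line_cap a b : a != 0 -> b != 0 -> ~~ (b <= a)%MS ->
  \dim (line a :&: line b) = 1%N.
Proof.
by move=> a0 b0 ba; apply: dimv2_cap (dim_line a0) (dim_line b0) _; rewrite line_sub.
Qed.

Lemma dimv1_cap_eq (U W1 W2 : {vspace 'rV[C]_3}) :
  \dim (U :&: W1) = 1%N -> \dim (U :&: W2) = 1%N ->
  (U :&: W1 == U :&: W2)%VS = (U :&: W2 <= W1)%VS.
Proof.
move=> d1 d2; rewrite eq_sym eqEdim d1 d2 leqnn andbT.
by rewrite subv_cap capvSl.
Qed.

Lemma line_cap_eq a b c : a != 0 -> b != 0 -> c != 0 -> ~~ (b <= a)%MS -> ~~ (c <= a)%MS ->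
  (line a :&: line b == line a :&: line c)%VS = (b <= a + c)%MS.
Proof.
move=> a0 b0 c0 ba ca; apply: etrans (line_capE a c b).
exact: dimv1_cap_eq (dim_line_cap a0 b0 ba) (dim_line_cap a0 c0 ca).
Qed.

(** The multiple points on a line are its intersections with the other lines. *)
Lemma num_points A a s : perm_eq (forms A) (a :: s) ->
  num_multiple_points_on A a = npoints a s.
Proof.
move=> p; have [us s0' ds'] := forms_distinct A.
have dA : distinct_lines (a :: s).
  split; first by rewrite -(perm_uniq p).
    by move=> b; rewrite -(perm_mem p); apply: s0'.
  by move=> b c; rewrite -!(perm_mem p); apply: ds'.
have [a0 ds sa] := distinct_cons dA; have [_ s0 _] := ds.
pose pts := [seq (line a :&: line b)%VS | b <- s].
have -> : npoints a s = size (undup pts).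
  apply: size_undup_map => b c bs cs; apply: esym.
  apply: etrans (line_cap_eq a0 (s0 b bs) (s0 c cs) (sa b bs) (sa c cs)) _.
  by rewrite pencil_eq ?sa // trace_on_sub ?sa.
have dpt b (bs : b \in s) := dim_line_cap a0 (s0 b bs) (sa b bs).
have count_a (q : {vspace 'rV[C]_3}) : (q <= line a)%VS ->
    (2 <= count (fun b => (q <= line b)%VS) (forms A))%N = has (fun b => (q <= line b)%VS) s.
  exact: (@count_perm_cons _ _ _ _ (fun b => (q <= line b)%VS) p).
rewrite /num_multiple_points_on.
have -> : multiple_points_on A a = [set` [fset q in pts]%fset]%classic.
  apply/seteqP; split=> q /=.
    move=> [[q1 cq] qa]; rewrite in_fset.
    have /hasP[b bs qb] := etrans (esym (count_a q qa)) cq.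
    apply/mapP; exists b => //; apply/eqP.
    by rewrite eqEdim q1 (dpt b bs) leqnn andbT subv_cap; apply/andP.
  rewrite in_fset => /mapP[b bs ->]; split; last exact: capvSl.
  split; first exact: dpt.
  apply: etrans (count_a _ (capvSl _ _)) _; apply/hasP.
  by exists b => //; apply: capvSr.
by rewrite set_fsetK card_fseq.
Qed.

(** ** Isomorphisms of intersection lattices *)

Definition meet s : {vspace 'rV[C]_3} := (\bigcap_(a <- s) line a)%VS.

Lemma meetP s (U : {vspace 'rV[C]_3}) :
  (U <= meet s)%VS <-> {in s, forall a, (U <= line a)%VS}.
Proof.
rewrite /meet; elim: s => [|a s ih]; first by rewrite big_nil subvf; split.
rewrite big_cons subv_cap; split=> [/andP[Ua /ih h] b|h].
  by rewrite inE => /orP[/eqP -> //|/h].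
by rewrite h ?mem_head //=; apply/ih => b bs; apply: h; rewrite inE bs orbT.
Qed.

Lemma meet_sub s a : a \in s -> (meet s <= line a)%VS.
Proof. by move=> h; apply: (meetP s (meet s)).1 h. Qed.

Lemma meet1 a : meet [:: a] = line a.
Proof. by rewrite /meet big_seq1. Qed.

Lemma meet2 a b : meet [:: a; b] = (line a :&: line b)%VS.
Proof. by rewrite /meet big_cons big_seq1. Qed.

Lemma in_lattice A s : {subset s <= forms A} -> intersection_lattice A (meet s).
Proof. by move=> h; exists s. Qed.

Lemma lattice_line A a : a \in forms A -> intersection_lattice A (line a).
Proof.
by move=> aA; rewrite -meet1; apply: in_lattice => x; rewrite inE => /eqP ->.
Qed.

Lemma line_neq_full a : a != 0 -> line a != fullv.
Proof.
move=> a0; apply/eqP => e; have := dim_line a0.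
by rewrite e dimvf.
Qed.

Section Isomorphism.
Variables (A B : arrangement R) (phi : {vspace 'rV[C]_3} -> {vspace 'rV[C]_3}).
Hypothesis phi_bij : set_bij (intersection_lattice A) (intersection_lattice B) phi.
Hypothesis phi_le : forall X Y, intersection_lattice A X -> intersection_lattice A Y ->
  (phi X <= phi Y)%VS = (X <= Y)%VS.

Lemma phi_full : phi fullv = fullv.
Proof.
have fA : intersection_lattice A fullv by exists [::]; rewrite ?big_nil.
have fB : intersection_lattice B fullv by exists [::]; rewrite ?big_nil.
have [_ _ surj] := phi_bij; have [X AX eX] := surj _ fB.
apply/eqP; rewrite eqEsubv subvf -{1}eX phi_le ?subvf //.
Qed.

(** The lines are the maximal proper elements of the lattice, so that they are
    preserved by isomorphisms. *)
Lemma sub_line A' X : intersection_lattice A' X -> X != fullv ->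
  exists2 a, a \in forms A' & (X <= line a)%VS.
Proof.
move=> [[|a s] hs ->]; first by rewrite big_nil eqxx.
by exists a; [apply: hs; rewrite mem_head | apply: (@meet_sub (a :: s)); rewrite mem_head].
Qed.

Lemma phi_line a : a \in forms A -> exists2 b, b \in forms B & phi (line a) = line b.
Proof.
move=> aA; have [fn inj surj] := phi_bij.
have nzA := (forms_distinct A); have nzB := (forms_distinct B).
have La := lattice_line aA.
have fA : intersection_lattice A fullv by exists [::]; rewrite ?big_nil.
have pa : phi (line a) != fullv.
  case: nzA => _ /(_ a aA)/line_neq_full/eqP ne _; apply/eqP => e; apply: ne.
  by apply: inj; rewrite ?in_setE // phi_full.
have [b bB lb] := sub_line (fn _ La) pa; exists b => //.
have b0 : b != 0 by case: nzB => _ ->.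
have [X AX eX] : exists2 X, intersection_lattice A X & phi X = line b.
  exact/surj/lattice_line.
have aX : (line a <= X)%VS by rewrite -phi_le // eX.
have Xf : X != fullv.
  by apply/eqP => e; move: eX; rewrite e phi_full => /esym; apply/eqP/line_neq_full.
have [c cA Xc] := sub_line AX Xf.
have [a0 c0] : a != 0 /\ c != 0 by case: nzA => _ nz _; rewrite !nz.
suff -> : line a = X by [].
apply/subv_anti/andP; split; [exact: aX | apply: (subv_trans Xc)].
have ca : (c <= a)%MS := etrans (esym (line_sub a c)) (subv_trans aX Xc).
exact: etrans (line_sub c a) (submx_rV_sym c0 ca).
Qed.

Lemma phi_line_surj b : b \in forms B -> exists2 a, a \in forms A & phi (line a) = line b.
Proof.
move=> bB; have [fn inj surj] := phi_bij.
have [_ nzB _] := forms_distinct B.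
have [X AX eX] : exists2 X, intersection_lattice A X & phi X = line b.
  exact/surj/lattice_line.
have Xf : X != fullv.
  by apply/eqP => e; move: eX; rewrite e phi_full => /esym; apply/eqP/line_neq_full/nzB.
have [a aA Xa] := sub_line AX Xf; exists a => //.
have La := lattice_line aA.
have [b' b'B eb'] := phi_line aA.
have le1 : (line b <= line b')%VS by rewrite -eX -eb' phi_le.
have b'b : (b' <= b)%MS := etrans (esym (line_sub b b')) le1.
rewrite eb'; apply/subv_anti/andP; split; last exact: le1.
exact: etrans (line_sub b' b) (submx_rV_sym (nzB _ b'B) b'b).
Qed.

(** The intersection of lines is their greatest lower bound in the lattice. *)
Lemma phi_meet psi s : {subset s <= forms A} ->
  {in forms A, forall a, psi a \in forms B /\ phi (line a) = line (psi a)} ->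
  phi (meet s) = meet [seq psi a | a <- s].
Proof.
move=> sA hpsi; have [fn inj surj] := phi_bij.
have psB : {subset [seq psi a | a <- s] <= forms B}.
  by move=> _ /mapP[a /sA aA ->]; case: (hpsi a aA).
have [X AX eX] : exists2 X, intersection_lattice A X & phi X = meet [seq psi a | a <- s].
  exact/surj/in_lattice.
have As := in_lattice sA.
apply/subv_anti/andP; split.
  apply/meetP => _ /mapP[a as' ->]; have [_ <-] := hpsi a (sA a as').
  by rewrite phi_le //; [apply: meet_sub | apply/lattice_line/sA].
rewrite -eX phi_le //; apply/meetP => a as'.
rewrite -phi_le //; last exact/lattice_line/sA.
by rewrite eX; have [_ ->] := hpsi a (sA a as'); apply/meet_sub/map_f.
Qed.

Lemma phi_on_lines : exists psi : 'rV[C]_3 -> 'rV[C]_3,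
  {in forms A, forall a, psi a \in forms B /\ phi (line a) = line (psi a)}.
Proof.
suff /boolp.choice[psi hpsi] : forall a, exists b, a \in forms A ->
    b \in forms B /\ phi (line a) = line b by exists psi.
move=> a; have [aA|aA] := boolP (a \in forms A); last by exists a.
by have [b bB e] := phi_line aA; exists b.
Qed.

Variable psi : 'rV[C]_3 -> 'rV[C]_3.
Hypothesis hpsi : {in forms A, forall a, psi a \in forms B /\ phi (line a) = line (psi a)}.

Lemma psi_inj : {in forms A &, injective psi}.
Proof.
move=> a b aA bA e; have [_ inj _] := phi_bij.
have le : line a = line b.
  apply: inj; [exact/mem_set/lattice_line | exact/mem_set/lattice_line | ].
  exact: etrans (hpsi aA).2 (etrans (congr1 (@line R) e) (esym (hpsi bA).2)).
exact: (uniq_map_injective (lines_uniq A)) le.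
Qed.

Lemma psi_perm : perm_eq (forms B) [seq psi a | a <- forms A].
Proof.
have [uA _ _] := forms_distinct A; have [uB _ _] := forms_distinct B.
apply: uniq_perm => //; first by rewrite (map_inj_in_uniq psi_inj).
move=> b; apply/idP/mapP => [bB|[a aA ->]]; last by case: (hpsi aA).
have [a aA ea] := phi_line_surj bB; exists a => //.
have [pB epa] := hpsi aA.
exact: (uniq_map_injective (lines_uniq B)) bB pB (etrans (esym ea) epa).
Qed.

Lemma psi_incidence : same_incidence psi (forms A).
Proof.
move=> x y z xA yA zA.
have sub : {subset [:: x; y] <= forms A} by move=> w; rewrite !inE => /orP[]/eqP ->.
have := phi_le (in_lattice sub) (lattice_line zA).
rewrite (phi_meet sub hpsi) /= !meet2.
have [_ ->] := hpsi zA => e.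
exact: etrans (esym (line_capE x y z)) (etrans (esym e) (line_capE _ _ _)).
Qed.

(** The isomorphism [phi] itself restricts to the sublattices. *)
Lemma sub_same_combinatorics (A' B' : arrangement R) :
  {subset forms A' <= forms A} -> forms B' = [seq psi a | a <- forms A'] ->
  same_combinatorics A' B'.
Proof.
move=> A'A eB'; have sAL s : {subset s <= forms A'} -> {subset s <= forms A}.
  by move=> h a /h/A'A.
have LL X : intersection_lattice A' X -> intersection_lattice A X.
  by move=> [s /sAL hs ->]; apply: in_lattice.
exists phi; split; last by move=> X Y /LL AX /LL AY; apply: phi_le.
have [fn inj surj] := phi_bij; split.
- move=> _ [s hs ->]; rewrite -/(meet s) (phi_meet (sAL s hs) hpsi).
  by apply: in_lattice => _ /mapP[a /hs aA ->]; rewrite eB' map_f.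
- move=> X Y /set_mem/LL AX /set_mem/LL AY; apply: inj; exact: mem_set.
move=> _ [t ht ->]; rewrite eB' in ht.
have [s hs ->] : exists2 s, {subset s <= forms A'} & t = [seq psi a | a <- s].
  elim: t ht => [|b t ih] ht; first by exists [::].
  have [s hs ->] : exists2 s, {subset s <= forms A'} & t = [seq psi a | a <- s].
    by apply: ih => x xt; apply: ht; rewrite inE xt orbT.
  have /mapP[a aA ->] := ht b (mem_head _ _).
  by exists (a :: s) => // x; rewrite inE => /orP[/eqP ->|/hs].
exists (meet s); first exact: in_lattice.
exact: (phi_meet (sAL s hs) hpsi).
Qed.

End Isomorphism.
End Lattice.

Theorem theorem4p3 (R : realType) (A B : arrangement R) (d1 d2 : nat)
  (hmin : minimal_counterexample A B)
  (hexp : free_with_exponents A d1 d2)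
  (L : 'rV[R[i]%C]_3) (hL : L \in forms A) :
  (num_multiple_points_on A L <= d1)%N.
Proof.
have [[phi [phi_bij phi_le]] _ nfB min] := hmin.
have [d12 [e [be h1 h2]]] := hexp.
have [psi hpsi] := phi_on_lines phi_bij phi_le.
pose s := rem L (forms A).
have p : perm_eq (forms A) (L :: s) := perm_to_rem hL.
have pB : perm_eq (forms B) [seq psi a | a <- L :: s].
  exact: perm_trans (psi_perm phi_bij phi_le hpsi) (perm_map psi p).
have das := perm_distinct p (forms_distinct A).
have dpas := perm_distinct pB (forms_distinct B).
have inc : same_incidence psi (L :: s).
  move=> x y z xs ys zs; have mem_s := perm_mem p.
  by apply: (psi_incidence phi_bij phi_le hpsi); rewrite mem_s.
(* With more than [d1] points on [L], freeness would pass to [B]. *)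
rewrite (num_points p) leqNgt; apply/negP => ltr; apply: nfB.
have [_ ds _] := distinct_cons das; have [_ dps _] := distinct_cons dpas.
have [A' eA'] := sub_arrangement ds; have [B' eB'] := sub_arrangement dps.
have [] := @free_transfer _ psi L s d1 d2 e (@pchar_num _) das dpas inc _ h1 h2 d12 ltr _.
- by apply: is_basis_eq be => v; apply: perm_syz.
- move=> [e' be']; have : terao_holds A' B'.
    apply: min; first by rewrite eA' eB' size_map.
    by rewrite eA' (perm_size p).
  case.
  + apply: (sub_same_combinatorics phi_bij phi_le hpsi); last by rewrite eB' eA'.
    by move=> a; rewrite eA'; apply: mem_rem.
  + exists 2%N, e'; apply: is_basis_eq be' => v; rewrite -eA'; exact: iff_refl.
  move=> m [f bf]; exists m, f; apply: is_basis_eq bf => v.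
  by have := D0_syz B' v; rewrite eB'.
move=> f bf; exists 2%N, f; apply: is_basis_eq bf => v.
by apply: iff_sym; apply: perm_syz pB.
Qed.
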